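(* Let $m,d\ge1$ be integers and let $I\subset\mathbb{R}^m$ be a compact set of positive Lebesgue measure. Assume that the $\mathbb{R}^d$-valued stochastic process $V=\{v(x),\ x\in\mathbb{R}^m\}$ is continuous, Gaussian and centered, with independent, identically distributed components $\{v_i(x),\ x\in\mathbb{R}^m\}$, $i=1,\dots,d$, and that $\inf_{x\in I^{(1)}}\operatorname{Var}(v_1(x))>0$. Fix $\delta\in\,]0,1]$ and, for $\varepsilon\in\,]0,1[$ and $j=(j_1,\dots,j_m)\in\mathbb{Z}^m$, set $R_j^\varepsilon=\prod_{l=1}^m[j_l\,\varepsilon^{1/\delta},(j_l+1)\,\varepsilon^{1/\delta}]$. Suppose that there is a constant $C$ such that for any $\varepsilon>0$ small enough and any $R_j^\varepsilon$ with $R_j^\varepsilon\cap I\ne\varnothing$, $$E\left(\int_{R_j^\varepsilon}dy\int_{R_j^\varepsilon}d\bar y\ \exp\left\{\frac{\|v(y)-v(\bar y)\|}{\|y-\bar y\|^{\delta}}\right\}\right)\le C\,\varepsilon^{\frac{2m}{\delta}}.$$ Then there is a constant $C$ such that for every $z\in\mathbb{R}^d$, every $\varepsilon>0$ small enough and every $R_j^\varepsilon$ with $R_j^\varepsilon\cap I\neq\varnothing$, $$P\{v(R_j^\varepsilon)\cap B_\varepsilon(z)\ne\varnothing\}\le C\,\varepsilon^d.$$ Consequently, there is a constant $C$ such that for any Borel set $A\subset\mathbb{R}^d$, $$P\{v(I)\cap A\ne\varnothing\}\le C\,\mathcal{H}_{d-\frac{m}{\delta}}(A).$$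
   Context: For a set $S$, $v(S)$ denotes its (random) image under $x\mapsto v(x)$. $\|\cdot\|$ is the Euclidean norm and $B_r(x)$ is the open Euclidean ball with center $x$ and radius $r$. For $S\subset\mathbb{R}^n$ and $\nu>0$, $S^{(\nu)}$ is the $\nu$-enlargement of $S$, i.e. the set of points at distance less than $\nu$ from $S$. Hausdorff measure: for a Borel set $A\subset\mathbb{R}^d$, $\mathcal{H}_\gamma(A)=\infty$ if $\gamma<0$, and for $\gamma\ge0$, $$\mathcal{H}_\gamma(A)=\lim_{\varepsilon\to0^+}\inf\left\{\sum_{i=1}^\infty(2r_i)^\gamma:\ A\subset\bigcup_{i=1}^\infty B_{r_i}(x_i),\ \sup_{i\ge1}r_i\le\varepsilon\right\}.$$ *)

(* Defs.v *)
From HB Require Import structures.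
From mathcomp Require Import all_boot all_order all_algebra.
From mathcomp Require Import all_classical all_reals all_analysis.
From mathcomp Require Import measurable_realfun.

Set Implicit Arguments.
Unset Strict Implicit.
Unset Printing Implicit Defensive.
Import Order.TTheory GRing.Theory Num.Theory.
Import numFieldNormedType.Exports.
Local Open Scope classical_set_scope.
Local Open Scope ring_scope.

HB.instance Definition _ (R : realType) (p n : nat) :=
  @isMeasurable.Build (sigma_display (@open 'M[R]_(p, n))) 'M[R]_(p, n)
    <<s @open 'M[R]_(p, n) >>
    (@sigma_algebra0 _ setT (@open 'M[R]_(p, n)))
    (@sigma_algebraC _ (@open 'M[R]_(p, n)))
    (@sigma_algebra_bigcup _ setT (@open 'M[R]_(p, n))).

Lemma borel_rVE (R : realType) n :
  (measurable : set (set 'rV[R]_n)) = <<s (@open 'rV[R]_n) >>.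
Proof. by []. Qed.

Definition tuple_rV (R : realType) n (t : n.-tuple R) : 'rV[R]_n :=
  \row_i tnth t i.

Lemma measurable_tuple_rV (R : realType) n :
  measurable_fun [set: n.-tuple R] (@tuple_rV R n).
Proof.
apply: (measurability (@open 'rV[R]_n)) => //.
move=> _ [U oU <-]; rewrite setTI.
pose B (p : 'rV[rat]_n * nat) : set 'rV[R]_n :=
  ball (map_mx ratr p.1 : 'rV[R]_n) p.2.+1%:R^-1.
have -> : U = \bigcup_p (if asbool (B p `<=` U) then B p else set0).
  apply/seteqP; split => [x Ux|x [p _]]; last first.
    by case: asboolP => // pU; exact: pU.
  have /nbhs_ballP[e /= e0 eU] : nbhs x U by exact: open_nbhs_nbhs.
  have [k ke] : exists k, (k.+1%:R : R)^-1 < e / 2.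
    have [k _ /(_ k (leqnn _))] :=
      near_infty_natSinv_lt (PosNum (divr_gt0 e0 (ltr0n R 2))).
    by exists k.
  have k0 : 0 < (k.+1%:R : R)^-1 by rewrite invr_gt0.
  have /choice[q qP] : forall i, exists q : rat,
      ball (x 0 i) k.+1%:R^-1 (ratr q : R).
    move=> i.
    have /rat_in_itvoo[q /itvP qx] : x 0 i < x 0 i + k.+1%:R^-1 by rewrite ltrDl.
    exists q; rewrite /ball/= distrC ger0_norm ?subr_ge0 ?qx//.
    by rewrite ltrBlDl qx.
  have Bx : ball (map_mx ratr (\row_i q i) : 'rV[R]_n) k.+1%:R^-1 x.
    by split=> // i j; rewrite !mxE ord1; apply: ball_sym; exact: qP.
  exists (\row_i q i, k) => //=; rewrite asboolT// => y yB; apply: eU.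
  apply: (@le_ball _ _ _ (k.+1%:R^-1 + k.+1%:R^-1)).
    by rewrite [leRHS](splitr e) lerD// ltW.
  by apply: ball_triangle yB; exact: ball_sym.
rewrite preimage_bigcup; apply: countable_bigcupT_measurable => //.
move=> [q k]; case: ifP => _; last by rewrite preimage_set0.
rewrite (_ : _ @^-1` _ = \bigcap_(i in [set: 'I_n])
   ((fun t => tnth t i) @^-1` ball (ratr (q 0 i) : R) k.+1%:R^-1)).
  apply: fin_bigcap_measurable => // i _.
  rewrite -[X in measurable X]setTI; apply: measurable_tnth => //.
  exact: measurable_ball.
apply/seteqP; split => [t [_ tB] i _|t tB].
  by have := tB 0 i; rewrite !mxE.
split; first by rewrite invr_gt0.
by move=> i j; rewrite !mxE ord1; exact: tB.
Qed.

Definition cons_pair (R : realType) n (p : measurableTypeR R * n.-tuple R) :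
    n.+1.-tuple R :=
  [tuple of p.1 :: p.2].

Definition uncons_tuple (R : realType) n (t : n.+1.-tuple R) :
    measurableTypeR R * n.-tuple R :=
  (thead t, [tuple of behead t]).

Lemma cons_pairK (R : realType) n : cancel (@cons_pair R n) (@uncons_tuple R n).
Proof. by move=> [x t]; congr pair; apply/val_inj. Qed.

Lemma measurable_cons_pair (R : realType) n :
  measurable_fun setT (@cons_pair R n).
Proof. exact: measurable_cons. Qed.

Lemma measurable_uncons_tuple (R : realType) n :
  measurable_fun setT (@uncons_tuple R n).
Proof.
apply: measurable_fun_pair; last exact: measurable_behead.
exact: measurable_tnth.
Qed.

(* Pushforwards are measures only through a measurability proof that canonical
   structures cannot infer; [lebesgue_cons] and [lebesgue_rV] hide that proof. *)
Definition lebesgue_cons (R : realType) n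
    (mu : {sigma_finite_measure set (n.-tuple R) -> \bar R}) :
    set (n.+1.-tuple R) -> \bar R :=
  pushforward (@lebesgue_measure R \x mu)%E (@cons_pair R n).

HB.instance Definition _ (R : realType) n
    (mu : {sigma_finite_measure set (n.-tuple R) -> \bar R}) :=
  Measure.copy (lebesgue_cons mu)
    (measure_function_pushforward__canonical__measure_function_Measure
      (@lebesgue_measure R \x mu)%E (@measurable_cons_pair R n)).

Lemma lebesgue_cons_sigma_finite (R : realType) n
    (mu : {sigma_finite_measure set (n.-tuple R) -> \bar R}) :
  sigma_finite setT (lebesgue_cons mu).
Proof.
have /sigma_finiteP[F [TF ndF Foo]] := sigma_finiteT (@lebesgue_measure R).
have /sigma_finiteP[G [TG ndG Goo]] := sigma_finiteT mu.
exists (fun k => @uncons_tuple R n @^-1` (F k `*` G k)).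
  apply/seteqP; split=> // t _.
  have [i _ Fi] : (\bigcup_i F i) (uncons_tuple t).1 by rewrite -TF.
  have [j _ Gj] : (\bigcup_j G j) (uncons_tuple t).2 by rewrite -TG.
  exists (maxn i j) => //; split.
  - by move: Fi; exact/subsetPset/ndF/leq_maxl.
  - by move: Gj; exact/subsetPset/ndG/leq_maxr.
move=> k; have [mF Fk] := Foo k; have [mG Gk] := Goo k; split.
  rewrite -[X in measurable X]setTI.
  by apply: measurable_uncons_tuple => //; exact: measurableX.
rewrite /lebesgue_cons /pushforward -comp_preimage.
rewrite (_ : _ \o _ = id) ?preimage_id; last exact/funext/cons_pairK.
by rewrite product_measure1E// lte_mul_pinfty// ge0_fin_numE.
Qed.

HB.instance Definition _ (R : realType) n
    (mu : {sigma_finite_measure set (n.-tuple R) -> \bar R}) :=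
  Measure_isSigmaFinite.Build _ _ _ (lebesgue_cons mu)
    (lebesgue_cons_sigma_finite mu).

Fixpoint lebesgue_tuple (R : realType) n :
    {sigma_finite_measure set (n.-tuple R) -> \bar R} :=
  match n with
  | 0 => \d_([tuple] : 0.-tuple R)
  | n'.+1 => lebesgue_cons (lebesgue_tuple R n')
  end.

Definition lebesgue_rV (R : realType) n : set 'rV[R]_n -> \bar R :=
  pushforward (lebesgue_tuple R n) (@tuple_rV R n).

HB.instance Definition _ (R : realType) n :=
  Measure.copy (@lebesgue_rV R n)
    (measure_function_pushforward__canonical__measure_function_Measure
      (lebesgue_tuple R n) (@measurable_tuple_rV R n)).

Lemma lebesgue_tuple_box (R : realType) n (a b : 'I_n -> R) :
  (forall i, a i <= b i) ->
  lebesgue_tuple R n [set t | forall i, a i <= tnth t i <= b i] =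
  (\prod_(i < n) (b i - a i))%:E.
Proof.
elim: n a b => [|n IH] a b ab /=.
  by rewrite big_ord0 diracE mem_set// => -[].
rewrite /lebesgue_cons /pushforward.
rewrite (_ : _ @^-1` _ = `[a ord0, b ord0] `*`
    [set t : n.-tuple R | forall i, a (lift ord0 i) <= tnth t i <= b (lift ord0 i)]).
  have mbox : measurable [set t : n.-tuple R |
      forall i, a (lift ord0 i) <= tnth t i <= b (lift ord0 i)].
    rewrite (_ : mkset _ = \bigcap_(i in [set: 'I_n])
        ((fun t => tnth t i) @^-1` `[a (lift ord0 i), b (lift ord0 i)])).
      apply: fin_bigcap_measurable => // i _.
      rewrite -[X in measurable X]setTI.
      by apply: measurable_tnth => //; exact: measurable_itv.
    apply/seteqP; split=> [t tB i _|t tB i] /=; first by rewrite in_itv/= tB.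
    by have := tB i I; rewrite /= in_itv.
  rewrite product_measure1E//= IH// lebesgue_measure_itv/= lte_fin.
  rewrite big_ord_recl; have [_|ba] := ltP.
    by rewrite -EFinB -EFinM.
  have -> : b ord0 = a ord0 by apply/eqP; rewrite eq_le ba ab.
  by rewrite subrr !mul0r mul0e.
apply/seteqP; split=> [[x t] /= H|[x t] /= [x0 H] i].
  split=> [|i]; first by rewrite in_itv/=; exact: (H ord0).
  by have := H (lift ord0 i); rewrite tnthS.
case: (unliftP ord0 i) => [j ->|->]; first by rewrite tnthS; exact: H.
by move: x0; rewrite in_itv.
Qed.

Lemma lebesgue_rV_box (R : realType) n (a b : 'rV[R]_n) :
  (forall l, a 0 l <= b 0 l) ->
  lebesgue_rV [set x : 'rV[R]_n | forall l, a 0 l <= x 0 l <= b 0 l] =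
  (\prod_(l < n) (b 0 l - a 0 l))%:E.
Proof.
move=> ab; rewrite /lebesgue_rV /pushforward -lebesgue_tuple_box//.
by congr (lebesgue_tuple R n _); apply/seteqP; split=> t /= H l;
  have := H l; rewrite mxE.
Qed.

Definition enorm (R : realType) n (x : 'rV[R]_n) : R :=
  Num.sqrt (\sum_(l < n) x 0 l ^+ 2).

Definition eball (R : realType) n (z : 'rV[R]_n) (r : R) : set 'rV[R]_n :=
  [set y | enorm (y - z) < r].

Definition enlargement (R : realType) n (S : set 'rV[R]_n) (nu : R) :
    set 'rV[R]_n :=
  [set x | exists2 y, S y & enorm (x - y) < nu].

(* A ball of radius 0 is empty and contributes 0 for every gamma; this matters
   only for gamma = 0, where 0 `^ 0 = 1, and lets finite covers compete. *)
Definition hausdorff_weight (R : realType) (gamma r : R) : R :=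
  if r == 0 then 0 else (2 * r) `^ gamma.

Definition hausdorff_content (R : realType) n (gamma eps : R)
    (A : set 'rV[R]_n) : \bar R :=
  ereal_inf [set s | exists (x : nat -> 'rV[R]_n) (r : nat -> R),
    [/\ A `<=` \bigcup_i eball (x i) (r i),
        (forall i, 0 <= r i <= eps) &
        s = (\sum_(0 <= i <oo) (hausdorff_weight gamma (r i))%:E)%E]].

Definition hausdorff (R : realType) n (gamma : R) (A : set 'rV[R]_n) : \bar R :=
  if gamma < 0 then +oo%E
  else lim (hausdorff_content gamma eps A @[eps --> 0^'+]).

(* [normal_prob m 0] is a junk value of the library, not the point mass at m. *)
Definition gaussian_law (R : realType) (m s : R) : set R -> \bar R :=
  if s == 0 then \d_m else normal_prob m s.

Definition gaussian_variable d (T : measurableType d) (R : realType)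
    (P : probability T R) (X : T -> R) :=
  exists m s : R, forall B : set R, measurable B ->
    P (X @^-1` B) = gaussian_law m s B.

Definition gaussian_family d (T : measurableType d) (R : realType)
    (P : probability T R) (J : Type) (X : J -> {RV P >-> R}) :=
  forall (n : nat) (j : 'I_n -> J) (c : 'I_n -> R),
    gaussian_variable P (fun w => \sum_(k < n) c k * X (j k) w).

(* The product sigma-algebra on the space of functions T -> R, on which the laws
   of real-valued processes indexed by T live. *)
Definition cylinder (R : realType) (T : Type) : set (set (T -> R)) :=
  <<s [set S | exists t (B : set R),
        measurable B /\ S = [set g | B (g t)]] >>.

Definition independent_processes d (O : measurableType d) (R : realType)
    (P : probability O R) (T : Type) (k : nat)
    (X : 'I_k -> T -> {RV P >-> R}) :=
  forall B : 'I_k -> set (T -> R), (forall i, cylinder (B i)) ->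
    P (\bigcap_(i in [set: 'I_k]) [set w | B i (fun t => X i t w)]) =
    (\prod_(i < k) P [set w | B i (fun t => X i t w)])%E.

Definition identically_distributed_processes d (O : measurableType d)
    (R : realType) (P : probability O R) (T : Type) (k : nat)
    (X : 'I_k -> T -> {RV P >-> R}) :=
  forall (i j : 'I_k) (B : set (T -> R)), cylinder B ->
    P [set w | B (fun t => X i t w)] = P [set w | B (fun t => X j t w)].

Definition vector_value d (O : measurableType d) (R : realType)
    (P : probability O R) (T : Type) (k : nat)
    (v : T -> 'I_k -> {RV P >-> R}) (w : O) (x : T) : 'rV[R]_k :=
  \row_i v x i w.

Definition grid_box (R : realType) n (delta eps : R) (j : 'rV[int]_n) :
    set 'rV[R]_n :=
  [set x | forall l, (j 0 l)%:~R * eps `^ delta^-1 <= x 0 l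
                       <= (j 0 l + 1)%:~R * eps `^ delta^-1].

Definition hits d (O : measurableType d) (R : realType)
    (P : probability O R) (T : Type) (k : nat)
    (v : T -> 'I_k -> {RV P >-> R}) (S : set T) (B : set 'rV[R]_k) : set O :=
  [set w | vector_value v w @` S `&` B !=set0].

(* The outer probability generated by P agrees with the completion of P on its
   domain; hitting events of Borel sets are analytic, hence measurable for
   the completion but not for P itself in general. *)
Definition outer_prob d (O : measurableType d) (R : realType)
    (P : probability O R) : set O -> \bar R := (P^*)%mu.

(* Main.v *)
Require Import Defs.
From HB Require Import structures.
From mathcomp Require Import all_boot all_order all_algebra.
From mathcomp Require Import all_classical all_reals all_analysis.
From mathcomp Require Import measurable_realfun.
From mathcomp Require Import ring lra zify.

Set Implicit Arguments.
Unset Strict Implicit.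
Unset Printing Implicit Defensive.
Import Order.TTheory GRing.Theory Num.Theory.
Import numFieldNormedType.Exports.
Local Open Scope classical_set_scope.
Local Open Scope ring_scope.

(** Two facts combine: a box on which V is not too rough cannot be hit unless V
is close to the target at one fixed point of the box, and the density of V at
that fixed point stays bounded even after weighting by the roughness.

Chaining. Let Q be a cube of side rho, put l = 1 / sqrt d, and let the
roughness of a path f be the double integral over Q * Q of
exp (l |f y - f y'| / |y - y'|^delta). If it is at most e^k rho^{2m}, then each
coordinate of f oscillates on Q by at most a constant times
rho^delta (1 + k): this is the Garsia-Rodemich-Rumsey argument, with cubes of
side 2^{-n} rho shrinking towards the given point ([chaining_oscillation]). Fix
a point x of the box with x in I, let rho^delta = eps, and suppose that V hits
the ball of centre z and radius eps on the box. Take the least k such that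
every |v_i x - z_i| is at most r_k = const * eps (k + 2). Minimality forces the
roughness to be at least e^k rho^{2m}, since a smaller roughness would give the
bound r_{k-1}; for k = 0 this lower bound holds for every path because the
integrand is at least 1. So the hitting event is covered by the events: V x is
within r_k of z in every coordinate, and the roughness is at least
e^k rho^{2m}.

Density under a tilt. The usual argument makes the increments independent of
V x by linear regression. This is avoidable: for a centred Gaussian pair (X, Y)
and a real t, the weight e^{t Y} only translates the law of X and multiplies
its mass by e^{t^2 E Y^2 / 2}, so that
  E (e^{t Y} ; |X - z| <= r) <= C (r / sigma) e^{t^2 E Y^2 / 2}
where sigma^2 = E X^2 ([gaussian_pair_density]). The bound is derived from the
Laplace transform: it determines the moments, hence the cosine and sine
transforms, and a Fejer kernel dominates the indicator of an interval. The d
components are independent, so the d bounds multiply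
([independent_expectation_prod_le]); the factor l in the exponent makes the
product of the exponential factors at most E exp (|V y - V y'| / |y - y'|^delta)
([expectation_increment_near]).

Conclusion. By Tonelli, the expected roughness over the event that V x is
within r_k of z is at most (C r_k / sigma)^d times the expectation in the
hypothesis, that is a constant times (eps (k + 2))^d rho^{2m}
([expectation_roughness_near]). Markov's inequality divides it by e^k rho^{2m}
([near_rough_le]), and the sum over k of e^{-k} (k + 2)^d converges
([hitting_box_le]). This is the first claim. As O(eps^{-m/delta}) boxes cover
I, V hits a ball of radius eps on I with probability at most
C eps^{d - m/delta}, and covering A by balls yields the Hausdorff measure
([outer_prob_hits_le_hausdorff]). *)

(** * Power series *)
(** The exponential series padded with zeros at odd ranks. The moments of a
centred Gaussian variable have this shape, so it is the common form of its
Laplace transform (with u = s^2 v / 2) and of its cosine transform (with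
u = - t^2 v / 2). *)
Lemma cvg_series_expR_even (R : realType) (u : R) :
  series (fun n => (~~ odd n)%:R * u ^+ n./2 / (n./2)`!%:R) @ \oo --> expR u.
Proof.
have -> : series (fun n => (~~ odd n)%:R * u ^+ n./2 / (n./2)`!%:R) =
    series (exp_coeff u) \o uphalf.
  apply/funext; elim=> [|n IH]; first by rewrite /= !seriesEnat /= !big_geq.
  rewrite seriesSr IH /= uphalf_half.
  case: (odd n); rewrite /= ?mul0r ?addr0 ?mul1r ?add1n ?add0n //.
  by rewrite seriesSr.
apply: cvg_comp; last first.
  exact: (is_cvg_series_exp_coeff u).
move=> A [N _ NA]; exists N.*2 => // n /= Nn; apply: NA => /=.
by rewrite uphalf_half (leq_trans _ (leq_addl _ _))// -(doubleK N) half_leq.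
Qed.

Lemma cvg_series_expR (R : realType) (x : R) :
  series (exp_coeff x) @ \oo --> expR x.
Proof. exact: is_cvg_series_exp_coeff. Qed.

(** Uniqueness of power series coefficients, by induction on the rank: for small
s > 0 the terms of rank above n contribute O(s^{n+1}), so |a n| = O(s). *)
Lemma pseries_eq0 (R : realType) (a : R ^nat) :
  (forall s, series (fun n => a n * s ^+ n) @ \oo --> (0 : R)) ->
  forall n, a n = 0.
Proof.
move=> a0; have [C C0 aC] : exists2 C, 0 < C & forall n, `|a n| <= C.
  have h : cvgn (series (fun n => a n * 1 ^+ n)) by apply/cvg_ex; exists 0; exact: a0.
  have [C C0 aC] := pinfty_ex_gt0 (cvg_series_bounded h).
  by exists C => // n; have := aC n I; rewrite /= expr1n mulr1.
move=> n; elim/ltn_ind: n => n IH.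
suff small s : 0 < s -> s <= 1/2 -> `|a n| <= 2 * C * s.
  apply/eqP/negPn/negP => an0.
  have an : 0 < `|a n| by rewrite normr_gt0.
  pose s := Num.min (1/2) (`|a n| / (4 * C)).
  have s0 : 0 < s by rewrite lt_min !divr_gt0// mulr_gt0.
  have := small _ s0; rewrite ge_min lexx => /(_ isT).
  have : s <= `|a n| / (4 * C) by rewrite ge_min lexx orbT.
  rewrite ler_pdivlMr ?mulr_gt0//; nra.
move=> s0 s1.
have sn : 0 < s ^+ n by rewrite exprn_gt0.
rewrite -(ler_pM2r sn); rewrite leNgt; apply/negP => H.
pose e := `|a n| * s ^+ n - 2 * C * s * s ^+ n.
have e0 : 0 < e by rewrite subr_gt0.
have /cvgrPdist_lt/(_ e e0)[N _ /(_ (maxn N n.+1) (leq_maxl _ _))] := a0 s.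
rewrite sub0r normrN; apply/negP; rewrite -leNgt.
set K := maxn N n.+1; have nK : (n < K)%N by rewrite leq_maxr.
rewrite seriesEnat/= (big_cat_nat (n := n))//=; last exact: ltnW.
rewrite big_nat_cond big1 ?add0r; last first.
  by move=> i; rewrite andbT => /IH ->; rewrite mul0r.
rewrite big_ltn//.
rewrite (le_trans _ (lerB_normD _ _))// normrM normrX (gtr0_norm s0) /e.
rewrite lerB// (le_trans (ler_norm_sum _ _ _))//.
apply: (@le_trans _ _ (\sum_(n.+1 <= i < K) C * s ^+ i)).
  by apply: ler_sum => i _; rewrite normrM normrX (gtr0_norm s0) ler_wpM2r// exprn_ge0// ltW.
rewrite -mulr_sumr -(subnKC nK) geometric_partial_tail.
rewrite (_ : 2 * C * s * s ^+ n = C * (2 * s ^+ n.+1)); last by rewrite exprS; ring.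
apply: ler_wpM2l; first exact: ltW.
rewrite (le_trans (@geometric_le_lim R _ _ _ _ _ _)) => //.
- by rewrite exprn_ge0// ltW.
- by rewrite gtr0_norm//; lra.
rewrite ler_pdivrMr; last lra.
have : 0 < s ^+ n.+1 by rewrite exprn_gt0.
nra.
Qed.

(** * Moments and Fourier transform of a Gaussian weight *)

Section weighted_moments.
Context d (T : measurableType d) (R : realType) (mu : {measure set T -> \bar R}).
Variables (w Y : T -> R).
Hypotheses (mw : measurable_fun setT w) (mY : measurable_fun setT Y).
Hypothesis w0 : forall t, 0 <= w t.
Hypothesis wY : forall s, (\int[mu]_t (w t * expR (s * Y t))%:E < +oo)%E.

Definition weighted_moment (n : nat) : R := \int[mu]_t (w t * Y t ^+ n).

Lemma integrable_weighted_abs (s : R) :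
  mu.-integrable setT (EFin \o (fun t => w t * expR (`|s| * `|Y t|))).
Proof.
have me u : measurable_fun setT (fun t => w t * expR (u * Y t)).
  by apply: measurable_funM => //; apply: measurableT_comp => //;
     apply: measurable_funM.
have mi u : mu.-integrable setT (EFin \o (fun t => w t * expR (u * Y t))).
  apply/integrableP; split; first exact/measurable_EFinP.
  under eq_integral do rewrite /= ger0_norm ?mulr_ge0 ?expR_ge0//.
  exact: wY.
apply: (@le_integrable _ _ _ mu setT measurableT _ (EFin \o
   ((fun t => w t * expR (s * Y t)) \+ (fun t => w t * expR ((-s) * Y t))))) => //.
- apply/measurable_EFinP; apply: measurable_funM => //.
  by apply: measurableT_comp => //; apply: measurable_funM => //;
     exact: measurableT_comp.
- move=> t _ /=; rewrite lee_fin [leLHS]ger0_norm ?mulr_ge0 ?expR_ge0//.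
  rewrite [leRHS]ger0_norm ?addr_ge0 ?mulr_ge0 ?expR_ge0//.
  rewrite -mulrDr ler_wpM2l// -normrM.
  by have [h|h] := ger0P (s * Y t); rewrite mulNr ?lerDl ?lerDr expR_ge0.
- exact: (integrableD measurableT (mi s) (mi (-s))).
Qed.

Lemma integrable_weighted_pow n :
  mu.-integrable setT (EFin \o (fun t => w t * Y t ^+ n)).
Proof.
apply: (@le_integrable _ _ _ mu setT measurableT _
  (EFin \o (fun t => n`!%:R * (w t * expR (`|1 : R| * `|Y t|))))) => //.
- by apply/measurable_EFinP; apply: measurable_funM => //; exact: measurable_funX.
- move=> t _ /=; rewrite lee_fin normrM (ger0_norm (w0 t)) [leRHS]ger0_norm; last first.
    by rewrite mulr_ge0// mulr_ge0// expR_ge0.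
  rewrite mulrCA ler_wpM2l// normr1 mul1r normrX -ler_pdivrMl ?ltr0n ?fact_gt0//.
  rewrite mulrC; have := @nondecreasing_cvgn_le _ (series (exp_coeff `|Y t|)).
  move=> /(_ _ (is_cvg_series_exp_coeff _) n.+1) h.
  apply: le_trans (h _); last first.
    apply: nondecreasing_series => k _ _.
    by rewrite /exp_coeff/= divr_ge0// exprn_ge0.
  rewrite seriesSr lerDr seriesEnat sumr_ge0// => k _.
  by rewrite divr_ge0// exprn_ge0.
- have := @integrableZl _ _ _ mu setT measurableT n`!%:R _ (integrable_weighted_abs 1).
  by apply: eq_integrable.
Qed.

(** Dominated convergence: the partial sums of the series are bounded by
exp |s Y|, whose weighted integral is finite. One statement serves the
exponential, the cosine and the sine. *)
Lemma integral_weighted_series (c : R ^nat) (g : R -> R) (s : R) :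
  (forall n, `|c n| <= 1) ->
  (forall y, series (fun n => c n * y ^+ n / n`!%:R) @ \oo --> g y) ->
  series (fun n => c n * weighted_moment n / n`!%:R * s ^+ n) @ \oo -->
    (\int[mu]_t (w t * g (s * Y t))).
Proof.
move=> c1 cg.
pose F N t := w t * series (fun n => c n * (s * Y t) ^+ n / n`!%:R) N.
have ipow := integrable_weighted_pow.
have iF N : mu.-integrable setT (EFin \o F N).
  elim: N => [|N IH].
    apply: (@eq_integrable _ _ _ mu setT measurableT (cst 0%:E)).
      by move=> t _; rewrite /F/= seriesEnat/= big_geq// mulr0.
    exact: integrable0.
  have -> : EFin \o F N.+1 = (EFin \o F N) \+
     (fun t => (c N * s ^+ N / N`!%:R)%:E * (w t * Y t ^+ N)%:E)%E.
    apply/funext => t; rewrite /F /= seriesSr -EFinM -EFinD; congr EFin.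
    rewrite exprMn; ring.
  by apply: integrableD => //; exact: (integrableZl measurableT _ (ipow N)).
have -> : series (fun n => c n * weighted_moment n / n`!%:R * s ^+ n) =
    fun N => \int[mu]_t F N t.
  apply/funext; elim=> [|N IH].
    under eq_Rintegral do rewrite /F seriesEnat/= big_geq// mulr0.
    by rewrite seriesEnat/= big_geq// Rintegral_cst// mul0r.
  rewrite seriesSr IH.
  have -> : F N.+1 = F N \+ (fun t => (c N * s ^+ N / N`!%:R) * (w t * Y t ^+ N)).
    by apply/funext => t; rewrite /F /= seriesSr exprMn; ring.
  rewrite RintegralD//; last first.
    by have := @integrableZl _ _ _ mu setT measurableT (c N * s ^+ N / N`!%:R) _ (ipow N).
  rewrite (RintegralZl _ measurableT (ipow N)).
  by rewrite /weighted_moment; congr (_ + _); ring.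
have Fg t : F ^~ t @ \oo --> w t * g (s * Y t).
  by rewrite /F /=; apply: cvgMr => //; exact: cg.
have mg : measurable_fun setT (fun t => w t * g (s * Y t)).
  apply: (@measurable_fun_cvg _ _ _ _ F) => [N|t _]; last exact: Fg.
  by have /integrableP[/measurable_EFinP] := iF N.
have [] := @dominated_convergence _ _ _ mu setT measurableT (fun N => EFin \o F N)
  (EFin \o (fun t => w t * g (s * Y t)))
  (EFin \o (fun t => w t * expR (`|s| * `|Y t|))).
- by move=> N; have /integrableP[] := iF N.
- exact/measurable_EFinP.
- by apply: aeW => t _; apply: cvg_EFin; [exact: nearW|exact: Fg].
- exact: integrable_weighted_abs.
- apply: aeW => t N _ /=; rewrite lee_fin /F normrM (ger0_norm (w0 t)) ler_wpM2l//.
  rewrite -normrM.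
  apply: (@le_trans _ _ (series (exp_coeff `|s * Y t|) N)); last first.
    apply: nondecreasing_cvgn_le; last exact: is_cvg_series_exp_coeff.
    apply: nondecreasing_series => k _ _.
    by rewrite /exp_coeff/= divr_ge0// exprn_ge0.
  rewrite !seriesEnat/= (le_trans (ler_norm_sum _ _ _))//; apply: ler_sum => k _.
  rewrite /exp_coeff/= normrM normrM normfV normrX (ger0_norm (ler0n R k`!)).
  rewrite ler_wpM2r ?invr_ge0//.
  by rewrite ler_piMl ?exprn_ge0.
move=> ig _ cvgI; apply: fine_cvg; rewrite fineK//.
exact: integrable_fin_num.
Qed.
End weighted_moments.

Section gaussian_weight.
Context d (T : measurableType d) (R : realType) (mu : {measure set T -> \bar R}).
Variables (w Y : T -> R) (K v : R).
Hypotheses (mw : measurable_fun setT w) (mY : measurable_fun setT Y).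
Hypothesis w0 : forall t, 0 <= w t.
Hypothesis wY : forall s : R,
  (\int[mu]_t (w t * expR (s * Y t))%:E = (K * expR (s ^+ 2 * v / 2))%:E)%E.

Let wYoo (s : R) : (\int[mu]_t (w t * expR (s * Y t))%:E < +oo)%E.
Proof. by rewrite wY ltry. Qed.

(** Both sides are Taylor coefficients, in s, of the given Laplace transform. *)
Lemma gaussian_moment n :
  weighted_moment mu w Y n / n`!%:R =
  K * (~~ odd n)%:R * (v / 2) ^+ n./2 / (n./2)`!%:R.
Proof.
apply/eqP; rewrite -subr_eq0; apply/eqP.
pose a n := weighted_moment mu w Y n / n`!%:R -
  K * (~~ odd n)%:R * (v / 2) ^+ n./2 / (n./2)`!%:R.
rewrite -/(a n); apply: pseries_eq0 => s.
have mom := @integral_weighted_series _ _ _ mu w Y mw mY w0 wYoo (cst 1) expR s.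
have {}mom : series (fun n => 1 * weighted_moment mu w Y n / n`!%:R * s ^+ n)
    @ \oo --> K * expR (s ^+ 2 * v / 2).
  have <- : \int[mu]_t (w t * expR (s * Y t)) = K * expR (s ^+ 2 * v / 2).
    by rewrite /Rintegral wY.
  apply: mom => [n0|y]; first by rewrite normr1.
  have -> : (fun n => cst 1 n * y ^+ n / n`!%:R) = exp_coeff y.
    by apply/funext => k; rewrite /exp_coeff/= mul1r.
  exact: cvg_series_expR.
have ev : (fun N => K * series (fun n => (~~ odd n)%:R * (s ^+ 2 * v / 2) ^+ n./2 /
    (n./2)`!%:R) N) @ \oo --> K * expR (s ^+ 2 * v / 2).
  by apply: cvgMr; exact: cvg_series_expR_even.
rewrite -[X in _ --> X](subrr (K * expR (s ^+ 2 * v / 2))).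
have -> : series (fun n => a n * s ^+ n) =
   (fun N => series (fun n => 1 * weighted_moment mu w Y n / n`!%:R * s ^+ n) N
    - K * series (fun n => (~~ odd n)%:R * (s ^+ 2 * v / 2) ^+ n./2 /
    (n./2)`!%:R) N).
  apply/funext => N; rewrite !seriesEnat/= mulr_sumr -sumrB; apply: eq_bigr => k _.
  rewrite /a mul1r mulrBl; congr (_ - _).
  have [ok|ok] := boolP (odd k); first by rewrite /= !(mulr0, mul0r).
  have E : (2 * k./2 = k)%N by rewrite mul2n; have := odd_double_half k; rewrite (negbTE ok).
  rewrite (_ : s ^+ k = (s ^+ 2) ^+ k./2); last by rewrite -exprM E.
  by rewrite -[s ^+ 2 * v / 2]mulrA [in RHS]exprMn /=; ring.
exact: cvgB.
Qed.

Lemma gaussian_moment_odd n : odd n -> weighted_moment mu w Y n = 0.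
Proof.
move=> on; have := gaussian_moment n; rewrite on /= mulr0 !mul0r => /eqP.
by rewrite mulf_eq0 invr_eq0 pnatr_eq0 (negbTE (lt0n_neq0 (fact_gt0 n))) orbF => /eqP.
Qed.

(** This replaces the analytic continuation of the Laplace transform to the
imaginary axis: the moments determine the transform term by term. *)
Lemma integral_gaussian_cos t :
  \int[mu]_x (w x * cos (t * Y x)) = K * expR (- t ^+ 2 * v / 2).
Proof.
have := @integral_weighted_series _ _ _ mu w Y mw mY w0 wYoo
  (fun n => (~~ odd n)%:R * (-1) ^+ n./2) cos t.
move=> /(_ _ _)/cvg_unique; apply=> //.
- move=> n; rewrite normrM normrX normrN normr1 expr1n mulr1.
  by case: odd; rewrite ?normr0 ?normr1.
- move=> y; have -> : (fun n => (~~ odd n)%:R * (-1) ^+ n./2 * y ^+ n / n`!%:R) =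
     cos_coeff y by [].
  rewrite unlock; exact: is_cvg_series_cos_coeff.
rewrite (_ : series _ = (fun N => K * series (fun n => (~~ odd n)%:R *
    (- t ^+ 2 * v / 2) ^+ n./2 / (n./2)`!%:R) N)).
  by apply: cvgMr; exact: cvg_series_expR_even.
apply/funext => N.
rewrite !seriesEnat/= mulr_sumr; apply: eq_bigr => k _.
rewrite -[_ * weighted_moment _ _ _ _ / _]mulrA gaussian_moment.
have [ok|ok] := boolP (odd k); first by rewrite /= !(mulr0, mul0r).
have E : (2 * k./2 = k)%N by rewrite mul2n; have := odd_double_half k; rewrite (negbTE ok).
rewrite (_ : t ^+ k = (t ^+ 2) ^+ k./2); last by rewrite -exprM E.
by rewrite -[- t ^+ 2 * v / 2]mulrA [in RHS]exprMn (exprNn (t ^+ 2)) /=; ring.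
Qed.

Lemma integral_gaussian_sin t : \int[mu]_x (w x * sin (t * Y x)) = 0.
Proof.
have := @integral_weighted_series _ _ _ mu w Y mw mY w0 wYoo
  (fun n => (odd n)%:R * (-1) ^+ n.-1./2) sin t.
move=> /(_ _ _)/cvg_unique; apply=> //.
- move=> n; rewrite normrM normrX normrN normr1 expr1n mulr1.
  by case: odd; rewrite ?normr0 ?normr1.
- move=> y; have -> : (fun n => (odd n)%:R * (-1) ^+ n.-1./2 * y ^+ n / n`!%:R) =
     sin_coeff y by [].
  rewrite unlock; exact: is_cvg_series_sin_coeff.
have -> : series (fun n => (odd n)%:R * (-1) ^+ n.-1./2 * weighted_moment mu w Y n
   / n`!%:R * t ^+ n) = cst 0.
  apply/funext => N; rewrite seriesEnat/= big1// => k _.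
  have [ok|ok] := boolP (odd k); last by rewrite !mul0r.
  by rewrite gaussian_moment_odd// mulr0 !mul0r.
exact: cvg_cst.
Qed.

End gaussian_weight.

(** * Anticoncentration of a Gaussian weight *)
Lemma integrable_sum_EFin d (T : measurableType d) (R : realType)
    (mu : {measure set T -> \bar R}) (I : Type) (s : seq I) (f : I -> T -> R) :
  (forall i, mu.-integrable setT (EFin \o f i)) ->
  mu.-integrable setT (EFin \o (fun x => \sum_(i <- s) f i x)).
Proof.
move=> fi; elim: s => [|i s IH].
  under [X in _ \o X]eq_fun do rewrite big_nil; exact: integrable0.
under [X in _ \o X]eq_fun do rewrite big_cons.
exact: (integrableD measurableT (fi i) IH).
Qed.

Lemma Rintegral_sum d (T : measurableType d) (R : realType)
    (mu : {measure set T -> \bar R}) (I : Type) (s : seq I) (f : I -> T -> R) :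
  (forall i, mu.-integrable setT (EFin \o f i)) ->
  \int[mu]_x (\sum_(i <- s) f i x) = \sum_(i <- s) \int[mu]_x f i x.
Proof.
move=> fi; elim: s => [|i s IH].
  by under eq_Rintegral do rewrite big_nil; rewrite Rintegral_cst// mul0r big_nil.
under eq_Rintegral do rewrite big_cons.
by rewrite RintegralD// ?IH ?big_cons//; exact: integrable_sum_EFin.
Qed.

(** Each row of the double sum is at most two geometric series of ratio
e^{-1/2}, because n^2 >= n for an integer n. *)
Lemma sum_expR_sqr_dist (R : realType) (N : nat) :
  \sum_(j < N) \sum_(k < N) expR (- (j%:R - k%:R) ^+ 2 / 2 : R) <=
  N%:R * (2 / (1 - expR (- (1/2)))).
Proof.
set q := expR (- (1/2)) : R.
have q0 : 0 < q by exact: expR_gt0.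
have q1 : q < 1 by rewrite -expR0 ltr_expR; lra.
have geo n : \sum_(0 <= i < n) q ^+ i <= (1 - q)^-1.
  have := @geometric_le_lim R n 1 q ler01 q0; rewrite gtr0_norm// div1r => /(_ q1).
  by rewrite /series/= ; under eq_bigr do rewrite /geometric/= mul1r.
have qd (n : nat) : expR (- n%:R ^+ 2 / 2 : R) <= q ^+ n.
  rewrite -expRM_natl ler_expR; have [->|n0] := posnP n; first by rewrite expr0n/=; lra.
  have : 1 <= (n%:R : R) by rewrite ler1n.
  nra.
rewrite mulr_natl (_ : _ *+ N = \sum_(j < N) (2 / (1 - q))); last first.
  by rewrite sumr_const card_ord.
apply: ler_sum => j _.
rewrite -(big_mkord xpredT (fun k => expR (- (j%:R - k%:R) ^+ 2 / 2 : R))).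
rewrite (big_cat_nat (n := j))//=; last exact/ltnW.
have -> : 2 / (1 - q) = (1 - q)^-1 + (1 - q)^-1 by ring.
apply: lerD.
  rewrite big_nat_rev/= (le_trans _ (geo j.+1))// big_nat_recl//=.
  rewrite -[leLHS]add0r lerD ?expr0 //.
  rewrite big_nat [leRHS]big_nat; apply: ler_sum => k /andP[_ kj].
  rewrite add0n (natrB _ kj) opprB addrCA subrr addr0; exact: qd.
rewrite -{1}[val j]add0n big_addn (le_trans _ (geo (N - j)%N))//.
apply: ler_sum => k _; rewrite natrD opprD addrCA subrr addr0 sqrrN; exact: qd.
Qed.

(** The Fejer kernel, equal to (sum_j cos (j th))^2 + (sum_j sin (j th))^2, is
nonnegative everywhere; near 0 each cosine of the first sum is at least 1/2. *)
Lemma fejer_ge (R : realType) (N : nat) (th : R) : 2 * N%:R * `|th| <= 1 ->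
  (N%:R ^+ 2) / 4 <= \sum_(j < N) \sum_(k < N) cos ((j%:R - k%:R) * th).
Proof.
move=> th1; under eq_bigr do under eq_bigr do rewrite mulrBl cosB.
under eq_bigr do rewrite big_split/= -!mulr_sumr.
rewrite big_split/= -!mulr_suml -!expr2.
apply: (@le_trans _ _ ((\sum_(i < N) cos (i%:R * th)) ^+ 2)); last first.
  by rewrite lerDl sqr_ge0.
have -> : N%:R ^+ 2 / 4 = (N%:R / 2) ^+ 2 :> R by rewrite expr_div_n; congr (_ / _); ring.
have c2 (i : 'I_N) : 1/2 <= cos (i%:R * th).
  set y := i%:R * th.
  have y2 : `|y *+ 2| <= 1.
    rewrite -mulr_natl /y !normrM !normr_nat (le_trans _ th1)//.
    rewrite -mulrA ler_wpM2l// ler_wpM2r// ler_nat; exact/ltnW.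
  have pi2 : 1 <= pi / 2 :> R by rewrite ler_pdivlMr// mul1r pi_ge2.
  have cpos (u : R) : `|u| <= 1 -> 0 <= cos u.
    rewrite ler_norml => /andP[u1 u2]; apply: cos_ge0_pihalf.
    by rewrite (le_trans u2 pi2) andbT (le_trans _ u1)// lerN2.
  have : 0 <= cos y.
    by apply: cpos; rewrite (le_trans _ y2)// normrMn -mulr_natl ler_peMl// ler1n.
  have := cpos _ y2; rewrite cos_mulr2n; nra.
have hs : N%:R / 2 <= \sum_(i < N) cos (i%:R * th).
  rewrite (_ : N%:R / 2 = \sum_(i < N) (1/2)); first exact: ler_sum.
  by rewrite sumr_const card_ord -[RHS]mulr_natl; ring.
by rewrite ler_sqr// nnegrE; [rewrite divr_ge0 | rewrite (le_trans _ hs)// divr_ge0].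
Qed.

Lemma fejer_ge0 (R : realType) (N : nat) (th : R) :
  0 <= \sum_(j < N) \sum_(k < N) cos ((j%:R - k%:R) * th).
Proof.
under eq_bigr do under eq_bigr do rewrite mulrBl cosB.
under eq_bigr do rewrite big_split/= -!mulr_sumr.
by rewrite big_split/= -!mulr_suml -!expr2 addr_ge0 ?sqr_ge0.
Qed.

(** With q = e^{-1/2}, the double sum of exponentials gives 8 / (1 - q); the
remaining factor 4 pays for rounding sg / (2 r) down to an integer. *)
Definition density_cst (R : realType) : R := 32 / (1 - expR (- (1/2))).

Lemma density_cst_gt0 (R : realType) : 0 < density_cst R.
Proof.
by rewrite divr_gt0// subr_gt0 -[X in _ < X]expR0 ltr_expR; lra.
Qed.

Lemma measurable_natb d (T : measurableType d) (R : realType) (b : T -> bool) :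
  measurable_fun setT b -> measurable_fun setT (fun t => (b t)%:R : R).
Proof.
by move=> mb; apply: (@measurableT_comp _ _ _ _ _ _ (fun c : bool => c%:R : R)).
Qed.

Section gaussian_weight_density.
Context d (T : measurableType d) (R : realType) (mu : {measure set T -> \bar R}).
Variables (w X : T -> R) (K c sg : R).
Hypotheses (mw : measurable_fun setT w) (mX : measurable_fun setT X).
Hypothesis w0 : forall t, 0 <= w t.
Hypothesis sg0 : 0 < sg.
Hypothesis wX : forall s : R, (\int[mu]_t (w t * expR (s * X t))%:E =
  (K * expR (s * c + s ^+ 2 * sg ^+ 2 / 2))%:E)%E.

Let Y t := (X t - c) / sg.

Let mY : measurable_fun setT Y.
Proof. by apply: measurable_funM => //; apply: measurable_funB. Qed.

Let wY (s : R) :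
  (\int[mu]_t (w t * expR (s * Y t))%:E = (K * expR (s ^+ 2 * 1 / 2))%:E)%E.
Proof.
under eq_integral.
  move=> t _.
  rewrite (_ : w t * _ = expR (- (s * c / sg)) * (w t * expR (s / sg * X t))); last first.
    rewrite [RHS]mulrCA -expRD; congr (_ * expR _); rewrite /Y; ring.
  rewrite EFinM; over.
rewrite ge0_integralZl_EFin ?expR_ge0//; last 2 first.
- by move=> t _; rewrite lee_fin mulr_ge0// expR_ge0.
- apply/measurable_EFinP; apply: measurable_funM => //.
  by apply: measurableT_comp => //; apply: measurable_funM.
rewrite wX -EFinM mulrCA -expRD; congr (_ * expR _)%:E; field.
by rewrite gt_eqF.
Qed.

Let iw : mu.-integrable setT (EFin \o w).
Proof.
apply/integrableP; split; first exact/measurable_EFinP.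
under eq_integral do rewrite /= ger0_norm//.
have := wY 0; under eq_integral do rewrite mul0r expR0 mulr1.
by move=> ->; rewrite ltry.
Qed.

Let wE : (\int[mu]_t (w t)%:E = K%:E)%E.
Proof.
have := wY 0; under eq_integral do rewrite mul0r expR0 mulr1.
by rewrite expr0n/= !mul0r expR0 mulr1.
Qed.

Let K0 : 0 <= K.
Proof. by rewrite -lee_fin -wE integral_ge0// => t _; rewrite lee_fin. Qed.

Let iwf (f : T -> R) : measurable_fun setT f -> (forall t, `|f t| <= 1) ->
  mu.-integrable setT (EFin \o (fun t => w t * f t)).
Proof.
move=> mf f1; apply: (@le_integrable _ _ _ mu setT measurableT _ (EFin \o w)) => //.
- by apply/measurable_EFinP; exact: measurable_funM.
- by move=> t _ /=; rewrite lee_fin normrM ler_piMr.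
Qed.

(** The sine transform of the centred weight vanishes, so a translation only
multiplies its cosine transform by a cosine. *)
Lemma gaussian_weight_cos (t z : R) :
  \int[mu]_x (w x * cos (t * ((X x - z) / sg))) <= K * expR (- t ^+ 2 * 1 / 2).
Proof.
set ze := t * ((z - c) / sg).
have mt : measurable_fun setT (fun x => t * Y x) by exact: measurable_funM.
have ic : mu.-integrable setT (EFin \o (fun x => w x * cos (t * Y x))).
  apply: iwf => [|x]; last exact: cos_max.
  by apply: measurableT_comp => //; apply: continuous_measurable_fun; exact: continuous_cos.
have is_ : mu.-integrable setT (EFin \o (fun x => w x * sin (t * Y x))).
  apply: iwf => [|x]; last exact: sin_max.
  by apply: measurableT_comp => //; apply: continuous_measurable_fun; exact: continuous_sin.
under eq_Rintegral.
  move=> x _.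
  rewrite (_ : t * ((X x - z) / sg) = t * Y x - ze); last by rewrite /ze /Y; ring.
  rewrite cosB mulrDr [w x * (cos _ * _)]mulrA [w x * (sin _ * _)]mulrA.
  rewrite [_ * cos ze]mulrC [_ * sin ze]mulrC.
  over.
rewrite RintegralD//; last 2 first.
- exact: (integrableZl measurableT _ ic).
- exact: (integrableZl measurableT _ is_).
rewrite (RintegralZl _ measurableT ic) (RintegralZl _ measurableT is_).
rewrite (integral_gaussian_sin mw mY w0 wY) mulr0 addr0.
rewrite (integral_gaussian_cos mw mY w0 wY).
by rewrite ler_piMl ?cos_le1// mulr_ge0// expR_ge0.
Qed.

(** The indicator of |X - z| <= r is dominated by 4 / N^2 times the Fejer kernel
of order N about sg / (2 r), evaluated at (X - z) / sg. The integral of the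
kernel is a double sum of Gaussian exponentials, of order N, hence the bound
K / N, that is K r / sg. *)
Lemma gaussian_weight_density (z r : R) : 0 < r ->
  (\int[mu]_t (w t * (`|X t - z| <= r)%R%:R)%:E <= (density_cst R * (K * r / sg))%:E)%E.
Proof.
move=> r0.
set q := 1 - expR (- (1/2)) : R.
have q0 : 0 < q by rewrite subr_gt0 -[X in _ < X]expR0 ltr_expR; lra.
have q1 : q <= 1 by rewrite gerBl expR_ge0.
have mi : measurable_fun setT (fun t => (`|X t - z| <= r)%R%:R : R).
  apply: (@measurable_natb _ _ _ (fun t => `|X t - z| <= r)).
  by apply: measurable_fun_ler => //; apply: measurableT_comp => //; apply: measurable_funB.
(* for r > sg / 2 the total mass K is already small enough *)
have [rs|rs] := leP (2 * r) sg; last first.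
  apply: (@le_trans _ _ K%:E).
    rewrite -wE; apply: ge0_le_integral => //.
    - by move=> t _; rewrite lee_fin mulr_ge0.
    - by apply/measurable_EFinP; exact: measurable_funM.
    - exact/measurable_EFinP.
    - by move=> t _; rewrite lee_fin ler_piMr// lern1 leq_b1.
  rewrite lee_fin /density_cst -/q.
  have h1 : 32 <= 32 / q by rewrite ler_pdivlMr// ler_piMr.
  have h2 : 1 / 2 <= r / sg by rewrite ler_pdivlMr//; lra.
  have : 1 <= 32 / q * (r / sg) by nra.
  rewrite (_ : 32 / q * (K * r / sg) = K * (32 / q * (r / sg))); last by ring.
  by move=> h; rewrite ler_peMr.
pose N := Num.truncn (sg / (2 * r)).
have N1 : (0 < N)%N by rewrite truncn_gt0 ler_pdivlMr ?mulr_gt0// mul1r.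
have Nsg : N%:R * (2 * r) <= sg.
  by rewrite -ler_pdivlMr ?mulr_gt0// truncn_le// divr_ge0 ?mulr_ge0// ltW.
have Nsg' : sg <= 4 * r * N%:R.
  have : sg / (2 * r) < N.+1%:R by exact: truncnS_gt.
  rewrite ltr_pdivrMr ?mulr_gt0// => /ltW/le_trans; apply.
  have : 1 <= N%:R :> R by rewrite ler1n.
  rewrite -natr1; nra.
have N0 : 0 < N%:R :> R by rewrite ltr0n.
pose D t := \sum_(j < N) \sum_(k < N) w t * cos ((j%:R - k%:R) * ((X t - z) / sg)).
have ijk (j k : 'I_N) : mu.-integrable setT
    (EFin \o (fun t => w t * cos ((j%:R - k%:R) * ((X t - z) / sg)))).
  apply: iwf => [|x]; last exact: cos_max.
  apply: measurableT_comp => //; first by apply: continuous_measurable_fun; exact: continuous_cos.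
  by apply: measurable_funM => //; apply: measurable_funM => //; apply: measurable_funB.
have iDj (j : 'I_N) : mu.-integrable setT
    (EFin \o (fun t => \sum_(k < N) w t * cos ((j%:R - k%:R) * ((X t - z) / sg)))).
  exact: integrable_sum_EFin.
have iD : mu.-integrable setT (EFin \o D) by exact: integrable_sum_EFin.
have DE t : D t = w t * \sum_(j < N) \sum_(k < N) cos ((j%:R - k%:R) * ((X t - z) / sg)).
  by rewrite mulr_sumr; apply: eq_bigr => j _; rewrite mulr_sumr.
have D0 t : 0 <= D t by rewrite DE mulr_ge0 ?fejer_ge0.
have mD : measurable_fun setT D by have /integrableP[/measurable_EFinP] := iD.
apply: (@le_trans _ _ (\int[mu]_t ((4 / N%:R ^+ 2)%:E * (D t)%:E))%E).
  apply: ge0_le_integral => //.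
  - by move=> t _; rewrite lee_fin mulr_ge0.
  - by apply/measurable_EFinP; exact: measurable_funM.
  - by apply/measurable_EFinP; exact: measurable_funM.
  - move=> t _; rewrite -EFinM lee_fin; have [tr|tr] := leP `|X t - z| r; last first.
      by rewrite mulr0 mulr_ge0// divr_ge0// exprn_ge0.
    rewrite mulr1 DE mulrCA ler_peMr//.
    rewrite mulrC -ler_pdivrMr ?divr_gt0 ?exprn_gt0//.
    rewrite div1r invf_div; apply: fejer_ge.
    rewrite normrM normfV (gtr0_norm sg0) mulrA ler_pdivrMr// mul1r.
    by rewrite (le_trans _ Nsg)// -mulrA mulrCA ler_wpM2l// ler_wpM2l.
rewrite ge0_integralZl_EFin//; [|by move=> t _; rewrite lee_fin|exact/measurable_EFinP].
have -> : (\int[mu]_t (D t)%:E = (\int[mu]_t D t)%:E)%E.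
  by rewrite fineK//; exact: integrable_fin_num.
rewrite -EFinM lee_fin Rintegral_sum//.
under eq_bigr do rewrite Rintegral_sum//.
apply: (@le_trans _ _ (4 / N%:R ^+ 2 * (K * (N%:R * (2 / q))))).
  apply: ler_wpM2l; first by rewrite divr_ge0// exprn_ge0.
  apply: (@le_trans _ _ (\sum_(j < N) \sum_(k < N) K * expR (- (j%:R - k%:R) ^+ 2 / 2))).
    apply: ler_sum => j _; apply: ler_sum => k _.
    by rewrite -[X in expR (X / 2)]mulr1; exact: gaussian_weight_cos.
  under eq_bigr do rewrite -mulr_sumr.
  by rewrite -mulr_sumr ler_wpM2l// sum_expR_sqr_dist.
rewrite /density_cst -/q.
rewrite (_ : 4 / N%:R ^+ 2 * (K * (N%:R * (2 / q))) = K * (8 / q / N%:R)); last first.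
  by field; rewrite !gt_eqF.
rewrite (_ : 32 / q * (K * r / sg) = K * (8 / q * (4 * r / sg))); last by ring.
rewrite ler_wpM2l// ler_wpM2l ?divr_ge0 ?(ltW q0)//.
by rewrite ler_pdivlMr// mulrC ler_pdivrMr.
Qed.
End gaussian_weight_density.

(** * Gaussian variables and Gaussian pairs *)
Section integral_density.
Context d (T : measurableType d) (R : realType).
Variables (mu nu : {measure set T -> \bar R}) (g : T -> R).
Hypotheses (mg : measurable_fun setT g) (g0 : forall t, 0 <= g t).
Hypothesis nuE : forall A, measurable A -> nu A = (\int[mu]_(t in A) (g t)%:E)%E.
Import HBNNSimple.

Let integral_density_indic A : measurable A ->
  (\int[nu]_t (\1_A t)%:E = \int[mu]_t (\1_A t * g t)%:E)%E.
Proof.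
move=> mA; rewrite integral_indic// setIT nuE// integral_mkcond.
by apply: eq_integral => t _; rewrite patchE indicE; case: ifPn; rewrite ?mul1r ?mul0r.
Qed.

Let integral_density_nnsfun (f : {nnsfun T >-> R}) :
  (\int[nu]_t (f t)%:E = \int[mu]_t (f t * g t)%:E)%E.
Proof.
under [LHS]eq_integral do rewrite fimfunE -fsumEFin//.
rewrite [LHS]ge0_integral_fsum//; last 2 first.
  - by move=> r; exact/measurable_EFinP/measurableT_comp.
  - by move=> n x _; rewrite EFinM nnfun_muleindic_ge0.
under [RHS]eq_integral.
  move=> x xD; rewrite EFinM muleC fimfunE -fsumEFin// ge0_mule_fsumr; last first.
    by move=> r; rewrite EFinM nnfun_muleindic_ge0.
  over.
rewrite [RHS]ge0_integral_fsum//; last 2 first.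
  - move=> r; apply/measurable_EFinP; apply: measurable_funM => //.
    exact/measurableT_comp.
  - move=> n x _; apply: mule_ge0; first by rewrite lee_fin.
    by rewrite EFinM nnfun_muleindic_ge0.
apply: eq_fsbigr => r _.
rewrite integralZl_indic_nnsfun//= integral_density_indic//.
have [r0|r0] := leP 0 r; last first.
  have E0 : f @^-1` [set r] = set0 by apply: preimage_nnfun0.
  rewrite E0; under eq_integral do rewrite indic0 mul0r.
  rewrite integral0 mule0; apply/esym.
  by under eq_integral do rewrite indic0 mulr0 mule0; rewrite integral0.
rewrite -ge0_integralZl_EFin//.
- by apply: eq_integral => x _; rewrite -!EFinM; congr EFin; ring.
- by move=> x _; rewrite lee_fin mulr_ge0.
- by apply/measurable_EFinP; apply: measurable_funM.
Qed.

Lemma ge0_integral_density (f : T -> R) :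
  measurable_fun setT f -> (forall t, 0 <= f t) ->
  (\int[nu]_t (f t)%:E = \int[mu]_t (f t * g t)%:E)%E.
Proof.
move=> mf f0.
have mEf : measurable_fun setT (EFin \o f) by exact/measurable_EFinP.
pose f_ := nnsfun_approx measurableT mEf.
have f_cvg t : EFin \o f_ ^~ t @ \oo --> (f t)%:E.
  by apply: cvg_nnsfun_approx => // x _; rewrite lee_fin.
transitivity (lim (\int[nu]_x (f_ n x)%:E @[n --> \oo])%E).
  rewrite -monotone_convergence//=.
  - apply: eq_integral => t _; apply/esym/cvg_lim => //; exact: f_cvg.
  - by move=> n; exact/measurable_EFinP/measurable_funTS.
  - by move=> n ? _; rewrite lee_fin.
  - by move=> ? _ ? ? mn; rewrite lee_fin; exact/lefP/nd_nnsfun_approx.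
transitivity (lim (\int[mu]_x (f_ n x * g x)%:E @[n --> \oo])%E).
  by apply: congr_lim; apply/funext => n /=; exact: integral_density_nnsfun.
rewrite -monotone_convergence//=.
- apply: eq_integral => t _; apply/cvg_lim => //.
  have -> : (fun n => (f_ n t * g t)%:E) = (fun n => (f_ n t)%:E * (g t)%:E)%E.
    by apply/funext => n; rewrite EFinM.
  by rewrite EFinM; apply: cvgeZr => //; exact: f_cvg.
- by move=> n; apply/measurable_EFinP; apply: measurable_funM.
- by move=> n ? _; rewrite lee_fin mulr_ge0.
- by move=> x _ a b ab; rewrite lee_fin ler_wpM2r//; exact/lefP/nd_nnsfun_approx.
Qed.
End integral_density.

Section normal_mgf.
Variable R : realType.
Local Notation leb := (@lebesgue_measure R).

(** Completing the square: e^{t x} times the density of N(m, s^2) is a multiple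
of the density of N(m + t s^2, s^2). *)
Lemma integral_normal_prob_expR (m s t : R) : s != 0 ->
  (\int[normal_prob m s]_x (expR (t * x))%:E =
   (expR (t * m + t ^+ 2 * s ^+ 2 / 2))%:E)%E.
Proof.
move=> s0.
rewrite (@ge0_integral_density _ _ _ leb _ (normal_pdf m s))//=.
- transitivity (\int[leb]_x ((expR (t * m + t ^+ 2 * s ^+ 2 / 2))%:E *
     (normal_pdf (m + t * s ^+ 2) s x)%:E))%E.
    apply: eq_integral => x _; rewrite -EFinM; congr EFin.
    rewrite !normal_pdfE// /normal_fun mulrCA [RHS]mulrCA -!expRD.
    by congr (_ * expR _); field.
  rewrite ge0_integralZl_EFin ?expR_ge0//.
  + by rewrite integral_normal_pdf mule1.
  + by move=> x _; rewrite lee_fin normal_pdf_ge0.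
  + by apply/measurable_EFinP; exact: measurable_normal_pdf.
- exact: measurable_normal_pdf.
- by move=> x; exact: normal_pdf_ge0.
- apply: measurableT_comp => //; exact: measurable_funM.
Qed.

End normal_mgf.

Section gaussian_variables.
Context d (T : measurableType d) (R : realType) (P : probability T R).

Lemma gaussian_variable_mgf (X : T -> R) : measurable_fun setT X ->
  gaussian_variable P X -> exists m s : R, forall t,
  (\int[P]_w (expR (t * X w))%:E = (expR (t * m + t ^+ 2 * s ^+ 2 / 2))%:E)%E.
Proof.
move=> mX [m [s lawX]]; exists m, s => t.
pose X' : T -> measurableTypeR R := X.
have mX' : measurable_fun setT X' by [].
have me : measurable_fun setT (fun x : measurableTypeR R => (expR (t * x))%:E).
  apply/measurable_EFinP; apply: measurableT_comp => //; exact: measurable_funM.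
have -> : (\int[P]_w (expR (t * X w))%:E =
    \int[pushforward P X']_x (expR (t * x))%:E)%E.
  by rewrite (ge0_integral_pushforward mX').
have [s0|s0] := eqVneq s 0.
  rewrite (eq_measure_integral (\d_ (m : measurableTypeR R))) => [|A mA _]; last first.
    by have := lawX A mA; rewrite /gaussian_law s0 eqxx.
  by rewrite integral_dirac//= diracT mul1e s0 expr0n/= mulr0 mul0r addr0.
rewrite -integral_normal_prob_expR//; apply: eq_measure_integral => A mA _.
by have := lawX A mA; rewrite /gaussian_law (negbTE s0).
Qed.

Definition second_moment (X : T -> R) : R := \int[P]_w (X w ^+ 2).

Lemma gaussian_variable_pow_integrable (X : T -> R) n : measurable_fun setT X ->
  gaussian_variable P X -> P.-integrable setT (EFin \o (fun w => X w ^+ n)).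
Proof.
move=> mX /(gaussian_variable_mgf mX)[m [s mgf]].
have := @integrable_weighted_pow _ _ _ P (cst 1) X (measurable_cst _) mX _ _ n.
have E : EFin \o (fun t => cst 1 t * X t ^+ n) = EFin \o (fun w => X w ^+ n).
  by apply/funext => w /=; rewrite mul1r.
rewrite E; apply => // t.
by under eq_integral do rewrite /= mul1r; rewrite mgf ltry.
Qed.

Lemma gaussian_variable_integrable (X : T -> R) : measurable_fun setT X ->
  gaussian_variable P X -> P.-integrable setT (EFin \o X).
Proof.
move=> mX gX; have := gaussian_variable_pow_integrable 1 mX gX.
by apply: eq_integrable => // w _ /=; rewrite expr1.
Qed.

(** The parameters m and s of the law are identified with the mean and the
variance through the moments of order 1 and 2. *)
Lemma centered_gaussian_mgf (X : T -> R) : measurable_fun setT X ->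
  gaussian_variable P X -> \int[P]_w X w = 0 -> forall t,
  (\int[P]_w (expR (t * X w))%:E = (expR (t ^+ 2 * second_moment X / 2))%:E)%E.
Proof.
move=> mX gX EX t.
have iX := gaussian_variable_integrable mX gX.
have iX2 := gaussian_variable_pow_integrable 2 mX gX.
have [m [s mgf]] := gaussian_variable_mgf mX gX.
suff [m0 s2] : m = 0 /\ second_moment X = s ^+ 2.
  by rewrite mgf m0 mulr0 add0r s2.
pose Y w := X w - m.
have mY : measurable_fun setT Y by exact: measurable_funB.
have wY (u : R) : (\int[P]_w (1 * expR (u * Y w))%:E =
    (1 * expR (u ^+ 2 * s ^+ 2 / 2))%:E)%E.
  under eq_integral.
    move=> w _; rewrite mul1r (_ : expR _ = expR (- (u * m)) * expR (u * X w)).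
      by rewrite EFinM; over.
    by rewrite -expRD; congr expR; rewrite /Y; ring.
  rewrite /= ge0_integralZl_EFin ?expR_ge0//.
  - by rewrite mgf -EFinM -expRD mul1r; congr (expR _)%:E; ring.
  - by apply/measurable_EFinP; apply: measurableT_comp => //; exact: measurable_funM.
have mom := gaussian_moment (measurable_cst (1:R)) mY (fun=> ler01) wY.
have EXm : \int[P]_w X w = m.
  have := mom 1%N; rewrite /= mulr0 !mul0r divr1 /weighted_moment.
  under eq_Rintegral do rewrite mul1r expr1.
  rewrite RintegralB//; last exact: finite_measure_integrable_cst.
  move=> h; apply/eqP; rewrite -subr_eq0; apply/eqP; rewrite -[RHS]h; congr (_ - _).
  rewrite -[LHS]mulr1 (Rintegral_cst P measurableT m); congr (m * _).
  rewrite -[LHS]/(fine 1%E); congr fine.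
  exact/esym/(@probability_setT _ _ _ P).
have m0 : m = 0 by rewrite -EXm.
split => //; have := mom 2%N; rewrite /weighted_moment /=.
have -> : \int[P]_t (1 * Y t ^+ 2) = second_moment X.
  by apply: eq_Rintegral => w _; rewrite mul1r /Y m0 subr0.
rewrite !mul1r expr1 divr1 => h.
by have := congr1 (fun x => x * 2) h; rewrite !divfK.
Qed.
End gaussian_variables.

Section gaussian_pair.
Context d (T : measurableType d) (R : realType) (P : probability T R).
Variables (X V : T -> R).
Hypotheses (mX : measurable_fun setT X) (mV : measurable_fun setT V).
Hypothesis gXV : forall a b : R, gaussian_variable P (fun w => a * X w + b * V w).
Hypotheses (EX : \int[P]_w X w = 0) (EV : \int[P]_w V w = 0).

Let gX : gaussian_variable P X.
Proof.
have := gXV 1 0; congr gaussian_variable; apply/funext => w; ring.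
Qed.

Let gV : gaussian_variable P V.
Proof.
have := gXV 0 1; congr gaussian_variable; apply/funext => w; ring.
Qed.

Let iXV : P.-integrable setT (EFin \o (X \* V)).
Proof.
have iX2 := gaussian_variable_pow_integrable 2%N mX gX.
have iV2 := gaussian_variable_pow_integrable 2%N mV gV.
apply: (@le_integrable _ _ _ P setT measurableT _
   (EFin \o (fun w => X w ^+ 2 + V w ^+ 2))) => //.
- by apply/measurable_EFinP; exact: measurable_funM.
- move=> w _ /=; rewrite lee_fin ler_norml (le_trans _ (ler_norm _)) ?andbT; last nra.
  rewrite lerNl (le_trans _ (ler_norm _))//; nra.
- exact: (integrableD measurableT iX2 iV2).
Qed.

Let rho : R := \int[P]_w (X w * V w).

(** Under the weight e^{l V}, the variable X is again Gaussian with the same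
variance; only its mean moves, to l rho. This is why the increments need not
be decorrelated from X. *)
Lemma gaussian_pair_mgf (s l : R) :
  (\int[P]_w (expR (l * V w) * expR (s * X w))%:E =
   (expR (l ^+ 2 * second_moment P V / 2) *
    expR (s * (l * rho) + s ^+ 2 * second_moment P X / 2))%:E)%E.
Proof.
have iX := gaussian_variable_integrable mX gX.
have iV := gaussian_variable_integrable mV gV.
have iX2 := gaussian_variable_pow_integrable 2%N mX gX.
have iV2 := gaussian_variable_pow_integrable 2%N mV gV.
pose Z w := s * X w + l * V w.
have mZ : measurable_fun setT Z by apply: measurable_funD; exact: measurable_funM.
have EZ : \int[P]_w Z w = 0.
  rewrite RintegralD//; last 2 first.
  - exact: (integrableZl measurableT s iX).
  - exact: (integrableZl measurableT l iV).
  by rewrite !RintegralZl// EX EV !mulr0 addr0.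
have := centered_gaussian_mgf mZ (gXV s l) EZ 1.
have -> : second_moment P Z = s ^+ 2 * second_moment P X +
   (2 * s * l * rho + l ^+ 2 * second_moment P V).
  rewrite /second_moment.
  rewrite (_ : (fun w => Z w ^+ 2) = (fun w => s ^+ 2 * X w ^+ 2 +
     (2 * s * l * (X w * V w) + l ^+ 2 * V w ^+ 2))); last first.
    by apply/funext => w; rewrite /Z; ring.
  have i1 := integrableZl measurableT (s ^+ 2) iX2.
  have i2 := integrableZl measurableT (2 * s * l) iXV.
  have i3 := integrableZl measurableT (l ^+ 2) iV2.
  have i23 := integrableD measurableT i2 i3.
  by rewrite !RintegralD// !RintegralZl.
rewrite -expRD => h.
rewrite (_ : (fun w => _) = (fun w => (expR (1 * Z w))%:E)); last first.
  by apply/funext => w; rewrite -expRD /Z mul1r addrC.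
by rewrite h; congr (expR _)%:E; field.
Qed.

Hypothesis X0 : 0 < second_moment P X.

Lemma gaussian_pair_density (z r l : R) : 0 < r ->
  (\int[P]_w (expR (l * V w) * (`|X w - z| <= r)%R%:R)%:E <=
   (density_cst R * (expR (l ^+ 2 * second_moment P V / 2) * r /
      Num.sqrt (second_moment P X)))%:E)%E.
Proof.
move=> r0.
apply: (@gaussian_weight_density _ _ _ P _ X _ (l * rho)) => //.
- by apply: measurableT_comp => //; exact: measurable_funM.
- by rewrite sqrtr_gt0.
- by move=> s; rewrite gaussian_pair_mgf sqr_sqrtr// ltW.
Qed.

(** Since e^{l |V|} <= e^{l V} + e^{- l V}. *)
Lemma gaussian_pair_density_abs (z r l : R) : 0 < r -> 0 <= l ->
  (\int[P]_w (expR (l * `|V w|) * (`|X w - z| <= r)%R%:R)%:E <=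
   (2 * density_cst R * (expR (l ^+ 2 * second_moment P V / 2) * r /
      Num.sqrt (second_moment P X)))%:E)%E.
Proof.
move=> r0 l0.
have mb : measurable_fun setT (fun t => (`|X t - z| <= r)%R%:R : R).
  apply: (@measurable_natb _ _ _ (fun t => `|X t - z| <= r)).
  by apply: measurable_fun_ler => //; apply: measurableT_comp => //; apply: measurable_funB.
have me (u : R) : measurable_fun setT (fun w => (expR (u * V w) * (`|X w - z| <= r)%R%:R)).
  apply: measurable_funM => //; apply: measurableT_comp => //; exact: measurable_funM.
apply: (@le_trans _ _ (\int[P]_w ((expR (l * V w) * (`|X w - z| <= r)%R%:R)%:E +
   (expR ((- l) * V w) * (`|X w - z| <= r)%R%:R)%:E))%E).
  apply: ge0_le_integral => //.
  - apply/measurable_EFinP; apply: measurable_funM => //.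
    apply: measurableT_comp => //; apply: measurable_funM => //; exact: measurableT_comp.
  - by apply: emeasurable_funD; exact/measurable_EFinP.
  - move=> w _; rewrite -EFinD lee_fin -mulrDl ler_wpM2r//.
    by have [h|h] := ger0P (V w); rewrite ?mulrN ?mulNr ?lerDl ?lerDr expR_ge0.
rewrite ge0_integralD//; try exact/measurable_EFinP.
apply: le_trans (leeD (gaussian_pair_density z l r0) (gaussian_pair_density z (- l) r0)) _.
rewrite -EFinD lee_fin sqrrN; lra.
Qed.

End gaussian_pair.

(** * Products over independent components *)
Definition path_gens (R : realType) (T : Type) : set (set (T -> R)) :=
  [set S | exists t (B : set R), measurable B /\ S = [set g | B (g t)]].

(** Functionals of a component are measurable functions on this space, so their
level sets are cylinders, to which independence applies. *)
Notation path_space R T := (g_sigma_algebraType (@path_gens R T)).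

Lemma measurable_path_eval (R : realType) (T : Type) (t : T) :
  measurable_fun setT (fun g : path_space R T => g t : R).
Proof.
by move=> _ B mB; rewrite setTI; apply: sub_sigma_algebra; exists t, B.
Qed.

Lemma cylinder_preimage (R : realType) (T : Type) (G : path_space R T -> R)
    (B : set R) :
  measurable_fun setT G -> measurable B -> cylinder (G @^-1` B).
Proof. by move=> mG mB; have := mG measurableT B mB; rewrite setTI. Qed.

Lemma measurable_path d (O : measurableType d) (R : realType)
    (P : probability O R) (T : Type) (Y : T -> {RV P >-> R}) :
  measurable_fun setT (fun w => (fun t => Y t w) : path_space R T).
Proof.
apply: (@measurability _ _ _ _ setT (fun w => (fun t => Y t w) : path_space R T)
  (@path_gens R T)) => // _ [_ [t [B [mB ->]]] <-].
exact: (measurable_funPT (Y t)).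
Qed.

(** Layer-cake discretisation of a number by n.+1 ^ 2 layers of height
1 / n.+1: a finite combination of indicators of half-lines, so that
independence of events is enough to integrate a product of such functions. *)
Definition layers (R : realType) (n : nat) (x : R) : R :=
  \sum_(j < n.+1 ^ 2) n.+1%:R^-1 * (j.+1%:R / n.+1%:R <= x)%R%:R.

(** The sum counts the integers between 1 and the minimum of M and y. *)
Lemma count_layers (R : realType) (M : nat) (y : R) : 0 <= y ->
  \sum_(j < M) (j.+1%:R <= y)%R%:R <= y /\
  (y < M%:R -> y - 1 <= \sum_(j < M) (j.+1%:R <= y)%R%:R).
Proof.
move=> y0.
have le_M N : \sum_(j < N) (j.+1%:R <= y)%R%:R <= N%:R :> R.
  apply: (@le_trans _ _ (\sum_(j < N) 1)); last by rewrite sumr_const card_ord.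
  by apply: ler_sum => j _; rewrite lern1 leq_b1.
suff : \sum_(j < M) (j.+1%:R <= y)%R%:R <= y /\
    (\sum_(j < M) (j.+1%:R <= y)%R%:R = M%:R :> R \/
    y - 1 <= \sum_(j < M) (j.+1%:R <= y)%R%:R).
  by move=> [h [h1|h1]]; split => // yM; rewrite h1; lra.
elim: M => [|M [IH1 IH2]]; first by rewrite big_ord0; split => //; left.
rewrite big_ord_recr/=; have [My|My] := leP M.+1%:R y; last first.
  rewrite addr0; split => //; right; case: IH2 => [->|//].
  by rewrite lerBlDr natr1 ltW.
rewrite /= mulr1n; split; first by rewrite (le_trans _ My)// -natr1 lerD2r le_M.
case: IH2 => [->|h]; first by left; rewrite natr1.
by right; rewrite (le_trans h)// lerDl.
Qed.

Lemma layersE (R : realType) n (x : R) :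
  layers n x = n.+1%:R^-1 * \sum_(j < n.+1 ^ 2) (j.+1%:R <= n.+1%:R * x)%R%:R.
Proof.
rewrite /layers mulr_sumr; apply: eq_bigr => j _.
by rewrite ler_pdivrMr ?ltr0n// mulrC [x * _]mulrC [RHS]mulrC.
Qed.

Lemma layers_ge0 (R : realType) n (x : R) : 0 <= layers n x.
Proof. by rewrite sumr_ge0// => j _; rewrite mulr_ge0. Qed.

Lemma layers_le (R : realType) n (x : R) : 0 <= x -> layers n x <= x.
Proof.
move=> x0; rewrite layersE ler_pdivrMl ?ltr0n//.
by have [] := @count_layers R (n.+1 ^ 2) (n.+1%:R * x) (mulr_ge0 (ler0n _ _) x0).
Qed.

Lemma cvg_layers (R : realType) (x : R) : 0 <= x -> (fun n => layers n x) @ \oo --> x.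
Proof.
move=> x0.
apply: (@squeeze_cvgr _ _ _ _ (fun n => x - n.+1%:R^-1) (fun=> x)).
- near=> n; rewrite layers_le// andbT layersE.
  have n0 : (0 : R) < n.+1%:R by rewrite ltr0n.
  rewrite ler_pdivlMl// mulrBr divff ?gt_eqF//.
  have [_ ->//] := @count_layers R (n.+1 ^ 2) (n.+1%:R * x) (mulr_ge0 (ler0n _ _) x0).
  rewrite natrX expr2 ltr_pM2l// (@lt_trans _ _ n%:R) ?ltr_nat//.
  by near: n; exact: nbhs_infty_gtr.
- rewrite -[X in _ --> X]subr0; apply: cvgB; first exact: cvg_cst.
  exact: cvg_harmonic.
- exact: cvg_cst.
Unshelve. all: by end_near. Qed.

Lemma cvg_prod_seq (R : realType) (I : Type) (r : seq I) (f : nat -> I -> R)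
    (g : I -> R) : (forall i, f ^~ i @ \oo --> g i) ->
  (fun n => \prod_(i <- r) f n i) @ \oo --> \prod_(i <- r) g i.
Proof.
move=> fg; elim: r => [|i r IH].
  by under eq_fun do rewrite big_nil; rewrite big_nil; exact: cvg_cst.
by under eq_fun do rewrite big_cons; rewrite big_cons; exact: cvgM.
Qed.

Section independent_product.
Context d (O : measurableType d) (R : realType) (P : probability O R).
Context (T : Type) (k : nat) (X : 'I_k -> T -> {RV P >-> R}).
Hypothesis indX : independent_processes X.

Lemma integral_prod_indic (A : 'I_k -> set O) : (forall i, measurable (A i)) ->
  (\int[P]_w (\prod_i \1_(A i) w)%:E = P (\bigcap_(i in [set: 'I_k]) A i))%E.
Proof.
move=> mA; rewrite -[in RHS](setIT (\bigcap_(i in _) _)) -integral_indic//; last first.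
  by apply: fin_bigcap_measurable.
apply: eq_integral => w _; congr EFin.
rewrite [in RHS]indicE; have [wA|wA] := boolP (w \in _).
  rewrite big1// => i _; rewrite indicE mem_set//.
  by move: wA; rewrite inE; exact.
apply/eqP/negPn/negP => h; move/negP: wA; apply; rewrite inE => i _.
apply: contrapT => Ai; move: h; rewrite (bigD1 i)//= indicE memNset// mul0r.
by rewrite eqxx.
Qed.

(** For discretised functions the product expands into indicators of
intersections, where independence applies; Fatou's lemma passes to the limit. *)
Lemma independent_expectation_prod_le (G : 'I_k -> path_space R T -> R)
    (c : 'I_k -> R) :
  (forall i, measurable_fun setT (G i)) -> (forall i g, 0 <= G i g) ->
  (forall i, (\int[P]_w (G i (fun t => X i t w))%:E <= (c i)%:E)%E) ->
  (\int[P]_w (\prod_i G i (fun t => X i t w))%:E <= (\prod_i c i)%:E)%E.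
Proof.
move=> mG G0 Gc.
pose Y i w : path_space R T := fun t => X i t w.
have mY i : measurable_fun setT (Y i) by exact: measurable_path.
have mGY i : measurable_fun setT (fun w => G i (Y i w)) by exact: measurableT_comp.
pose f n w := \prod_i layers n (G i (Y i w)).
have ml n i : measurable_fun setT (fun w => layers n (G i (Y i w))).
  apply: measurable_sum => j; apply: measurable_funM => //.
  apply: (@measurable_natb _ _ _ (fun w => j.+1%:R / n.+1%:R <= G i (Y i w))).
  exact: measurable_fun_ler.
have mf n : measurable_fun setT (f n) by apply: measurable_prod.
have f0 n w : 0 <= f n w by apply: prodr_ge0 => i _; exact: layers_ge0.
have fcvg w : (fun n => f n w) @ \oo --> \prod_i G i (Y i w).
  by apply: cvg_prod_seq => i; exact: cvg_layers.
rewrite (_ : (\int[P]_w _)%E = \int[P]_w (limn_einf (fun n => (f n w)%:E)))%E; last first.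
  apply: eq_integral => w _; apply/esym.
  by apply: (cvg_limn_einf_sup _).1; apply: cvg_EFin; [exact: nearW|exact: fcvg].
apply: (le_trans (@fatou _ _ _ P setT measurableT (fun n w => (f n w)%:E) _ _)).
- by move=> n; exact/measurable_EFinP.
- by move=> n w _; rewrite lee_fin.
suff fn n : (\int[P]_w (f n w)%:E <= (\prod_i c i)%:E)%E.
  rewrite limn_einf_lim; apply: lime_le; first exact: is_cvg_einfs.
  apply: nearW => n; apply: le_trans (fn n); apply: ereal_inf_lbound.
  by exists n => /=.
pose q : R := n.+1%:R^-1.
pose A i (j : 'I_(n.+1 ^ 2)) := [set w | (j.+1%:R / n.+1%:R <= G i (Y i w))%R].
have mA i j : measurable (A i j).
  have := @measurable_fun_le _ _ _ setT (cst (j.+1%:R / n.+1%:R)) _ measurableT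
    (measurable_cst _) (mGY i).
  by rewrite setTI.
have q0 : 0 <= q by rewrite invr_ge0.
have lE i w : layers n (G i (Y i w)) = \sum_j q * \1_(A i j) w.
  rewrite /layers; apply: eq_bigr => j _; congr (_ * _).
  rewrite indicE; congr (_%:R); congr nat_of_bool.
  by apply/idP/idP; rewrite inE.
pose a i j := q * fine (P (A i j)).
have ac i : \sum_j a i j <= c i.
  rewrite -lee_fin (le_trans _ (Gc i))//.
  apply: (@le_trans _ _ (\int[P]_w (layers n (G i (Y i w)))%:E)%E); last first.
    apply: ge0_le_integral => //.
    - by move=> w _; rewrite lee_fin layers_ge0.
    - exact/measurable_EFinP.
    - exact/measurable_EFinP.
    - by move=> w _; rewrite lee_fin layers_le.
  under eq_integral do rewrite lE -sumEFin.
  rewrite ge0_integral_sum//; last 2 first.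
  - by move=> j; apply/measurable_EFinP; apply: measurable_funM.
  - by move=> j w _; rewrite lee_fin mulr_ge0.
  rewrite -sumEFin; apply: lee_sum => j _.
  under eq_integral do rewrite EFinM.
  rewrite ge0_integralZl_EFin//; last exact/measurable_EFinP.
  by rewrite integral_indic// setIT /a EFinM fineK// fin_num_measure.
apply: (@le_trans _ _ (\prod_i \sum_j a i j)%:E); last first.
  rewrite lee_fin; apply: ler_prod => i _; rewrite ac andbT.
  by apply: sumr_ge0 => j _; rewrite mulr_ge0// fine_ge0.
rewrite bigA_distr_bigA -sumEFin.
under eq_integral.
  move=> w _; rewrite /f; under eq_bigr do rewrite lE.
  rewrite bigA_distr_bigA -sumEFin; over.
rewrite /= ge0_integral_sum//; last 2 first.
- by move=> g; apply/measurable_EFinP; apply: measurable_prod => i _; apply: measurable_funM.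
- by move=> g w _; rewrite lee_fin prodr_ge0// => i _; rewrite mulr_ge0.
apply: lee_sum => g _.
under eq_integral do rewrite big_split/= EFinM.
rewrite ge0_integralZl_EFin//=; first last.
- by apply: prodr_ge0.
- by apply/measurable_EFinP; apply: measurable_prod => i _; exact: measurable_indic.
- by move=> w _; rewrite lee_fin prodr_ge0.
rewrite integral_prod_indic//.
have cyl i : cylinder (G i @^-1` [set x | ((g i).+1%:R / n.+1%:R <= x)%R]).
  apply: cylinder_preimage => //.
  rewrite (_ : mkset _ = `[(g i).+1%:R / n.+1%:R, +oo[%classic).
    exact: measurable_itv.
  by apply/seteqP; split => x /=; rewrite in_itv/= andbT.
have := indX cyl; rewrite /A => ->.
rewrite (eq_bigr (fun i => (fine (P (A i (g i))))%:E)); last first.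
  by move=> i _; rewrite fineK// fin_num_measure.
by rewrite prodEFin -EFinM -big_split.
Qed.
End independent_product.

(** * Euclidean norm and cubes *)
Lemma enorm_ge0 (R : realType) n (x : 'rV[R]_n) : 0 <= enorm x.
Proof. exact: sqrtr_ge0. Qed.

Lemma ler_coord_enorm (R : realType) n (x : 'rV[R]_n) i : `|x 0 i| <= enorm x.
Proof.
rewrite -sqrtr_sqr ler_wsqrtr// (bigD1 i)//= lerDl sumr_ge0// => j _.
exact: sqr_ge0.
Qed.

Lemma enorm_le_coord (R : realType) n (x : 'rV[R]_n) (s : R) :
  0 <= s -> (forall i, `|x 0 i| <= s) -> enorm x <= Num.sqrt n%:R * s.
Proof.
move=> s0 xs; rewrite -[s in leRHS]ger0_norm// -sqrtr_sqr -sqrtrM// ler_wsqrtr//.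
rewrite mulr_natl (_ : _ *+ n = \sum_(i < n) s ^+ 2); last by rewrite sumr_const card_ord.
apply: ler_sum => i _.
by rewrite -real_normK ?num_real// ler_sqr ?nnegrE.
Qed.

Lemma enorm_eq0 (R : realType) n (x : 'rV[R]_n) : enorm x = 0 -> x = 0.
Proof.
move=> x0; apply/rowP => i; rewrite mxE; apply/eqP; rewrite -normr_le0 -x0.
exact: ler_coord_enorm.
Qed.

Lemma measurable_coord (R : realType) n (i : 'I_n) :
  measurable_fun setT (fun x : 'rV[R]_n => x 0 i).
Proof.
apply: (measurability _ (RGenOInfty.measurableE R)) => // _ [_ [a ->] <-].
rewrite setTI; apply: sub_sigma_algebra.
apply: open_comp => [x _|]; first exact: coord_continuous.
exact: rray_open.
Qed.

Lemma measurable_enorm d (T : measurableType d) (R : realType) n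
    (f : T -> 'rV[R]_n) : (forall i, measurable_fun setT (fun t => f t 0 i)) ->
  measurable_fun setT (fun t => enorm (f t)).
Proof.
move=> mf; apply: (@measurableT_comp _ _ _ _ _ _ (@Num.sqrt R)).
  by apply: continuous_measurable_fun; exact: sqrt_continuous.
by apply: measurable_sum => i; exact: measurable_funX.
Qed.

Definition cube (R : realType) n (a : 'rV[R]_n) (s : R) : set 'rV[R]_n :=
  [set x | forall l, a 0 l <= x 0 l <= a 0 l + s].

Lemma measurable_cube (R : realType) n (a : 'rV[R]_n) (s : R) :
  measurable (cube a s).
Proof.
rewrite (_ : cube a s = \bigcap_(l in [set: 'I_n])
    ((fun x : 'rV[R]_n => x 0 l) @^-1` `[a 0 l, a 0 l + s])); last first.
  apply/seteqP; split=> [x xB l _|x xB l] /=; first by rewrite in_itv/= xB.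
  by have := xB l I; rewrite /= in_itv.
apply: fin_bigcap_measurable => // l _.
by rewrite -[X in measurable X]setTI; apply: measurable_coord => //; exact: measurable_itv.
Qed.

Lemma lebesgue_cube (R : realType) n (a : 'rV[R]_n) (s : R) : 0 <= s ->
  lebesgue_rV (cube a s) = (s ^+ n)%:E.
Proof.
move=> s0; have := @lebesgue_rV_box R n a (a + const_mx s).
rewrite (_ : mkset _ = cube a s); last first.
  by apply/seteqP; split => x xB l; have := xB l; rewrite !mxE.
move=> ->; last by move=> l; rewrite !mxE lerDl.
congr EFin; rewrite -[X in _ ^+ X]card_ord -prodr_const.
by apply: eq_bigr => i _; rewrite !mxE addrAC subrr add0r.
Qed.

Lemma lebesgue_rV_sigma_finite (R : realType) n : sigma_finite setT (@lebesgue_rV R n).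
Proof.
exists (fun k => cube (const_mx (- k%:R)) (k%:R *+ 2)).
  apply/seteqP; split => // x _.
  pose k := (\max_(l < n) Num.bound `|x 0%R l|%R)%N.
  exists k => // l; rewrite !mxE mulr2n addrA addNr add0r -ler_norml.
  apply: (@le_trans _ _ (Num.bound `|x 0 l|)%:R); first exact/ltW/archi_boundP.
  by rewrite ler_nat (leq_bigmax l).
move=> k; split; first exact: measurable_cube.
by rewrite lebesgue_cube ?ltry// mulrn_wge0.
Qed.

HB.instance Definition _ (R : realType) n :=
  Measure_isSigmaFinite.Build _ _ _ (@lebesgue_rV R n)
    (@lebesgue_rV_sigma_finite R n).

(** If everywhere g1 exceeded three times its average bound or g2 did, then
g1 / b1 + g2 / b2 would be at least 3 / q on Q, whereas its integral is at
most 1 + 1. *)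
Lemma exists_pair_le_average d (T : measurableType d) (R : realType)
    (mu : {measure set T -> \bar R}) (Q : set T) (q b1 b2 : R)
    (g1 g2 : T -> \bar R) :
  measurable Q -> mu Q = q%:E -> 0 < q -> 0 < b1 -> 0 < b2 ->
  measurable_fun Q g1 -> measurable_fun Q g2 ->
  (forall y, 0 <= g1 y)%E -> (forall y, 0 <= g2 y)%E ->
  (\int[mu]_(y in Q) g1 y <= b1%:E)%E -> (\int[mu]_(y in Q) g2 y <= b2%:E)%E ->
  exists2 y, Q y & (g1 y <= (3 * b1 / q)%:E)%E /\ (g2 y <= (3 * b2 / q)%:E)%E.
Proof.
move=> mQ muQ q0 b10 b20 mg1 mg2 g10 g20 I1 I2; apply: contrapT => /forall2NP H.
have : (\int[mu]_(y in Q) (3 / q)%:E <=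
    \int[mu]_(y in Q) ((b1^-1)%:E * g1 y + (b2^-1)%:E * g2 y))%E.
  apply: ge0_le_integral => //.
  - by move=> y _; rewrite lee_fin divr_ge0// ltW.
  - by apply: emeasurable_funD; exact: measurable_funeM.
  - move=> y Qy; have [//|/not_andP[]/negP] := H y; rewrite -ltNge => h.
      apply: (@le_trans _ _ ((b1^-1)%:E * g1 y)%E); last first.
        by rewrite leeDl// mule_ge0// lee_fin invr_ge0 ltW.
      apply: (@le_trans _ _ ((b1^-1)%:E * (3 * b1 / q)%:E)%E).
        by rewrite -EFinM lee_fin le_eqVlt; apply/orP; left; apply/eqP; field; rewrite !gt_eqF.
      by apply: lee_wpmul2l; [rewrite lee_fin invr_ge0 ltW|exact: ltW].
    apply: (@le_trans _ _ ((b2^-1)%:E * g2 y)%E); last first.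
      by rewrite leeDr// mule_ge0// lee_fin invr_ge0 ltW.
    apply: (@le_trans _ _ ((b2^-1)%:E * (3 * b2 / q)%:E)%E).
      by rewrite -EFinM lee_fin le_eqVlt; apply/orP; left; apply/eqP; field; rewrite !gt_eqF.
    by apply: lee_wpmul2l; [rewrite lee_fin invr_ge0 ltW|exact: ltW].
rewrite integral_cst// [X in (_ * X)%E]muQ -EFinM divfK ?gt_eqF//.
rewrite ge0_integralD//=; last 4 first.
- by move=> y _; rewrite mule_ge0// lee_fin invr_ge0 ltW.
- exact: measurable_funeM.
- by move=> y _; rewrite mule_ge0// lee_fin invr_ge0 ltW.
- exact: measurable_funeM.
rewrite !ge0_integralZl//; try by rewrite lee_fin invr_ge0 ltW.
move=> h; have : ((3 : R)%:E <= (1 + 1)%:E)%E.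
  apply: (le_trans h); rewrite EFinD; apply: leeD.
    by rewrite -(mulVf (lt0r_neq0 b10)) EFinM; apply: lee_wpmul2l => //; rewrite lee_fin invr_ge0 ltW.
  by rewrite -(mulVf (lt0r_neq0 b20)) EFinM; apply: lee_wpmul2l => //; rewrite lee_fin invr_ge0 ltW.
rewrite lee_fin; lra.
Qed.

(** * Chaining on a cube *)
Lemma sum_succ_geometric_le (R : realType) (q : R) n : 0 <= q < 1 ->
  \sum_(i < n) i.+1%:R * q ^+ i <= (1 - q)^-1 ^+ 2.
Proof.
move=> /andP[q0 q1]; have q1' : 1 - q != 0 by rewrite subr_eq0 gt_eqF.
have qq : 0 < 1 - q by rewrite subr_gt0.
suff -> : \sum_(i < n) i.+1%:R * q ^+ i =
    (1 - q)^-1 ^+ 2 - q ^+ n * (n%:R / (1 - q) + (1 - q)^-1 ^+ 2).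
  rewrite gerBl mulr_ge0 ?exprn_ge0// addr_ge0 ?divr_ge0 ?exprn_ge0 ?invr_ge0// ltW//.
elim: n => [|n IH]; first by rewrite big_ord0 expr0 mul0r add0r mul1r subrr.
by rewrite big_ord_recr/= IH (exprS q) -natr1; field.
Qed.

Lemma continuous_coord_comp (R : realType) (T : topologicalType) (d : nat)
    (f : T -> 'rV[R]_d) (i : 'I_d) : continuous f -> continuous (fun y => f y 0 i).
Proof.
move=> cf u; apply: (@continuous_comp _ _ _ f (fun z : 'rV[R]_d => z 0 i)) => //.
  exact: cf.
exact: coord_continuous.
Qed.

(** The power of 2 sqrt m comes from the diameters of the cubes, 4 + 2 m from the
logarithm of the ratio of the roughness to the volumes, and the last factor
bounds the sum of (j + 1) q^j for q = 2^{-delta}. *)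
Definition chain_cst (R : realType) (m : nat) (delta : R) : R :=
  (2 * Num.sqrt m%:R) `^ delta * (4 + 2 * m%:R) *
  (1 - 2^-1 `^ delta)^-1 ^+ 2.

Lemma chain_cst_ge0 (R : realType) (m : nat) (delta : R) : 0 <= chain_cst m delta.
Proof.
by rewrite mulr_ge0 ?exprn_even_ge0// mulr_ge0 ?powR_ge0// addr_ge0// mulr_ge0.
Qed.

Section chaining.
Context (R : realType) (m d : nat).
Variables (f : 'rV[R]_m -> 'rV[R]_d) (delta l : R).
Hypotheses (delta0 : 0 < delta) (l0 : 0 < l).
Hypothesis cf : continuous f.

Definition exp_increment (y y' : 'rV[R]_m) : R :=
  expR (l * (enorm (f y - f y') / enorm (y - y') `^ delta)).
Local Notation F := exp_increment.

Hypothesis mF : measurable_fun setT (fun p : 'rV[R]_m * 'rV[R]_m => F p.1 p.2).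

Variables (a : 'rV[R]_m) (rho : R).
Hypothesis rho0 : 0 < rho.
Local Notation Q0 := (cube a rho).

Let G (y : 'rV[R]_m) : \bar R :=
  (\int[@lebesgue_rV R m]_(y' in Q0) (F y y')%:E)%E.

Let F0 y y' : 0 <= F y y'. Proof. exact: expR_ge0. Qed.

Let G0 y : (0 <= G y)%E.
Proof. by apply: integral_ge0 => y' _; rewrite lee_fin. Qed.

Let mFy y : measurable_fun setT (fun y' => (F y y')%:E).
Proof. by apply/measurable_EFinP; exact: (measurableT_comp mF (measurable_pair1 y)). Qed.

Let mG : measurable_fun setT G.
Proof.
rewrite (_ : G = fubini_F (@lebesgue_rV R m)
   (fun p : 'rV[R]_m * 'rV[R]_m => (F p.1 p.2 * \1_Q0 p.2)%:E)); last first.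
  apply/funext => y; rewrite /G /fubini_F [LHS]integral_mkcond; apply: eq_integral => y' _.
  by rewrite patchE indicE; case: ifPn => _; rewrite ?mulr1 ?mulr0.
apply: measurable_fun_fubini_tonelli_F => [|p]; last by rewrite lee_fin mulr_ge0.
apply/measurable_EFinP; apply: measurable_funM => //.
have mI : measurable_fun setT (\1_Q0 : 'rV[R]_m -> R).
  by apply: measurable_indic; exact: measurable_cube.
exact: (measurableT_comp mI measurable_snd).
Qed.

(* The image of Q0 under the contraction of ratio 2^-n towards x: it contains x
   and stays inside Q0 even when x lies on the boundary. *)
Let Qn (x : 'rV[R]_m) (n : nat) : set 'rV[R]_m :=
  cube (\row_i (a 0 i + (x 0 i - a 0 i) * (1 - 2^-1 ^+ n))) (rho * 2^-1 ^+ n).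

Let half_le1 n : (2^-1 : R) ^+ n <= 1.
Proof. by rewrite exprn_ile1// ?invr_ge0// invf_le1// ler1n. Qed.

Let half_gt0 n : 0 < (2^-1 : R) ^+ n.
Proof. by rewrite exprn_gt0// invr_gt0. Qed.

Let Qn_sub x n : Q0 x -> Qn x n `<=` Q0.
Proof.
move=> xQ y yQ i; have := yQ i; rewrite !mxE; have := xQ i.
have := half_le1 n; have := half_gt0 n.
set h := 2^-1 ^+ n; move=> h0 h1 /andP[x1 x2] /andP[y1 y2].
by apply/andP; split; nra.
Qed.

Let Qn_dist x n y : Q0 x -> Qn x n y -> forall i, `|x 0 i - y 0 i| <= rho * 2^-1 ^+ n.
Proof.
move=> xQ yQ i; have := yQ i; rewrite !mxE; have := xQ i.
have := half_le1 n; have := half_gt0 n.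
set h := 2^-1 ^+ n; move=> h0 h1 /andP[x1 x2] /andP[y1 y2].
by rewrite ler_norml; apply/andP; split; nra.
Qed.

Let Qn_vol x n : lebesgue_rV (Qn x n) = ((rho * 2^-1 ^+ n) ^+ m)%:E.
Proof. by rewrite lebesgue_cube// mulr_ge0 ?ltW// half_gt0. Qed.

Variable k : R.
Hypothesis k0 : 0 <= k.
Let b := expR k * rho ^+ (2 * m).
Hypothesis Gb : (\int[@lebesgue_rV R m]_(y in Q0) G y <= b%:E)%E.

Let b0 : 0 < b. Proof. by rewrite mulr_gt0 ?expR_gt0// exprn_gt0. Qed.

Let vol n := (rho * 2^-1 ^+ n) ^+ m.
Let vol0 n : 0 < vol n.
Proof. by rewrite exprn_gt0// mulr_gt0// half_gt0. Qed.

Let step n := Num.sqrt m%:R * (2 * (rho * 2^-1 ^+ n)).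

(** Taking logarithms in the bound on F. The factor 9 = 3 * 3 comes from two
applications of [exists_pair_le_average], and 9 <= 2^4 <= e^4. *)
Let increment_le y y' n i :
  F y y' <= 9 * b / (vol n * vol n.+1) -> enorm (y - y') <= step n ->
  l * `|f y 0 i - f y' 0 i| <= step n `^ delta * (4 + k + (2 * n + 1)%:R * m%:R).
Proof.
move=> Fb dyy'.
have s0 : 0 <= step n.
  by rewrite mulr_ge0 ?sqrtr_ge0// mulr_ge0// mulr_ge0// ltW// half_gt0.
(* for y = y' the quotient in F is 0 and carries no information *)
have [dy0|dy0] := eqVneq (enorm (y - y')) 0.
  have /eqP := enorm_eq0 dy0; rewrite subr_eq0 => /eqP ->.
  by rewrite subrr normr0 mulr0 mulr_ge0 ?powR_ge0// !addr_ge0// mulr_ge0.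
have dy1 : 0 < enorm (y - y') by rewrite lt_def dy0 enorm_ge0.
have hb : 9 * b / (vol n * vol n.+1) <= expR (4 + k + (2 * n + 1)%:R * m%:R).
  have e2 : 2 <= expR 1 :> R by have := expR_ge1Dx (1 : R).
  have e2n p : (2 : R) ^+ p <= expR p%:R.
    by rewrite -[p%:R]mulr1 expRM_natl; apply: lerXn2r; rewrite ?nnegrE ?expR_ge0.
  rewrite (_ : _ / _ = 9 * expR k * 2 ^+ ((2 * n + 1) * m)); last first.
    have V : vol n * vol n.+1 * 2 ^+ ((2 * n + 1) * m) = rho ^+ (2 * m).
      rewrite /vol !exprM -!exprMn; congr (_ ^+ m).
      rewrite exprD expr1 mulnC exprM [2^-1 ^+ n.+1]exprS.
      have : (2 : R) ^+ n * 2^-1 ^+ n = 1 by rewrite -exprMn divff// expr1n.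
      move: (2 ^+ n : R) (2^-1 ^+ n : R) => u h uh.
      transitivity ((u * h) ^+ 2 * rho ^+ 2); first by field.
      by rewrite uh expr1n mul1r.
    rewrite /b -V; field; rewrite !gt_eqF//.
  rewrite expRD expRD; apply: ler_pM; rewrite ?mulr_ge0 ?expR_ge0 ?exprn_ge0//.
    apply: ler_pM; rewrite ?expR_ge0//; rewrite (le_trans _ (e2n 4%N))//.
    by rewrite -natrX ler_nat.
  by rewrite -natrM; exact: e2n.
have := le_trans Fb hb; rewrite /exp_increment ler_expR mulrA ler_pdivrMr ?powR_gt0// => h.
apply: (@le_trans _ _ (l * enorm (f y - f y'))).
  have -> : f y 0 i - f y' 0 i = (f y - f y') 0 i by rewrite !mxE.
  by apply: (ler_wpM2l (ltW l0)); exact: ler_coord_enorm.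
rewrite (le_trans h)// mulrC ler_wpM2r//.
  by rewrite !addr_ge0// mulr_ge0.
by rewrite ge0_ler_powR// ?nnegrE// ltW.
Qed.

(** Each link picks, in the next cube, a point where both the partial integral G
(to continue the chain) and the integrand paired with the previous point (to
bound the increment) are at most three times their averages. *)
Let chain x : Q0 x -> forall y0, Q0 y0 -> (G y0 <= (3 * b / vol 0)%:E)%E ->
  forall n, exists y, [/\ Qn x n y, (G y <= (3 * b / vol n)%:E)%E &
    forall i, l * `|f y0 0 i - f y 0 i| <=
      \sum_(j < n) step j `^ delta * (4 + k + (2 * j + 1)%:R * m%:R)].
Proof.
move=> xQ y0 y0Q Gy0; elim=> [|n [y [yQ Gy fy]]].
  exists y0; split => //.
    by move=> i; have := y0Q i; rewrite !mxE expr0 subrr mulr0 addr0 mulr1.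
  by move=> i; rewrite subrr normr0 mulr0 big_ord0.
have mQ : measurable (Qn x n.+1) by exact: measurable_cube.
have [y' y'Q [Gy' Fyy']] : exists2 y', Qn x n.+1 y' &
    (G y' <= (3 * b / vol n.+1)%:E)%E /\
    ((F y y')%:E <= (3 * (3 * b / vol n) / vol n.+1)%:E)%E.
  apply: (@exists_pair_le_average _ _ _ (@lebesgue_rV R m)) => //.
  - exact: Qn_vol.
  - by rewrite divr_gt0// mulr_gt0.
  - exact: measurable_funTS.
  - exact: measurable_funTS.
  - by move=> y'; rewrite lee_fin.
  - apply: le_trans Gb; apply: ge0_subset_integral => //.
    + exact: measurable_cube.
    + exact: measurable_funTS.
    + exact: Qn_sub.
  - apply: le_trans Gy; apply: ge0_subset_integral => //.
    + exact: measurable_cube.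
    + exact: measurable_funTS.
    + by move=> y' _; rewrite lee_fin.
    + exact: Qn_sub.
exists y'; split => // i; rewrite big_ord_recr/=.
apply: (@le_trans _ _ (l * `|f y0 0 i - f y 0 i| + l * `|f y 0 i - f y' 0 i|)).
  rewrite -mulrDr; apply: (ler_wpM2l (ltW l0)); exact: ler_distD.
apply: lerD => //; apply: increment_le.
  move: Fyy'; rewrite lee_fin => /le_trans; apply.
  by rewrite le_eqVlt; apply/orP; left; apply/eqP; field; rewrite !gt_eqF.
apply: enorm_le_coord => [|j].
  by rewrite mulr_ge0// mulr_ge0// ltW// half_gt0.
rewrite !mxE; have := Qn_dist xQ yQ j; have := Qn_dist xQ y'Q j.
rewrite exprS; have := half_gt0 n; move: (2^-1 ^+ n) => h h0.
rewrite !ler_norml => /andP[u1 u2] /andP[v1 v2].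
have : 0 < rho * h by rewrite mulr_gt0.
by move=> rh; apply/andP; split; nra.
Qed.

Let chain_sum_le n :
  \sum_(j < n) step j `^ delta * (4 + k + (2 * j + 1)%:R * m%:R) <=
  chain_cst m delta * (rho `^ delta * (1 + k)).
Proof.
set q := 2^-1 `^ delta : R.
have q01 : 0 <= q < 1.
  have one : 1 `^ delta = 1 :> R by rewrite powR1.
  rewrite powR_ge0/= /q -[X in _ < X]one; apply: gt0_ltr_powR => //.
  - by rewrite nnegrE invr_ge0.
  - by rewrite nnegrE.
  - by rewrite invf_lt1// ltr1n.
have stepE j : step j `^ delta = (2 * Num.sqrt m%:R) `^ delta * rho `^ delta * q ^+ j.
  rewrite /step (_ : _ * _ = (2 * Num.sqrt m%:R) * rho * 2^-1 ^+ j); last by ring.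
  rewrite powRM ?mulr_ge0 ?sqrtr_ge0 ?ltW// powRM ?mulr_ge0 ?sqrtr_ge0 ?(ltW rho0)//.
  by rewrite -(@powR_mulrn _ 2^-1 j) ?invr_ge0// powRAC powR_mulrn ?powR_ge0.
apply: (@le_trans _ _ (\sum_(j < n) (2 * Num.sqrt m%:R) `^ delta * rho `^ delta *
    ((4 + 2 * m%:R) * (1 + k)) * (j.+1%:R * q ^+ j))).
  apply: ler_sum => j _; rewrite stepE.
  set A := _ `^ delta * _ `^ delta; have A0 : 0 <= A by rewrite mulr_ge0 ?powR_ge0.
  have [q0 _] := andP q01.
  rewrite [leRHS](_ : _ = A * q ^+ j * ((4 + 2 * m%:R) * (1 + k) * j.+1%:R)); last by ring.
  apply: ler_wpM2l; first by rewrite mulr_ge0// exprn_ge0.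
  rewrite natrD natrM -[j.+1]addn1 natrD.
  have := ler0n R j; have := ler0n R m; move: (j%:R : R) (m%:R : R) => J M M0 J0.
  have Mk : 0 <= M * k by rewrite mulr_ge0.
  have Jk : 0 <= J * k by rewrite mulr_ge0.
  have JM : 0 <= J * (M * k) by rewrite mulr_ge0.
  rewrite -subr_ge0 (_ : _ - _ =
    3 * k + M + 2 * (M * k) + 4 * J + 4 * (J * k) + 2 * (J * (M * k))); last by ring.
  by rewrite !addr_ge0// mulr_ge0.
rewrite -mulr_sumr /chain_cst -/q.
have := sum_succ_geometric_le n q01.
move: (\sum_(i < n) _) ((1 - q)^-1 ^+ 2) => S1 S2 S12.
rewrite (_ : _ * _ * S2 * _ = (2 * Num.sqrt m%:R) `^ delta * rho `^ delta *
    ((4 + 2 * m%:R) * (1 + k)) * S2); last by ring.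
by rewrite ler_wpM2l// !mulr_ge0 ?powR_ge0// addr_ge0// mulr_ge0.
Qed.

(** The chains towards x and towards x' start from the same point y0, and their
points converge to x and x', where continuity of f is used. *)
Lemma chaining_oscillation x x' i : Q0 x -> Q0 x' ->
  l * `|f x 0 i - f x' 0 i| <= 2 * chain_cst m delta * (rho `^ delta * (1 + k)).
Proof.
have mQ0 : measurable Q0 by exact: measurable_cube.
have vol0E : lebesgue_rV Q0 = (vol 0)%:E.
  by rewrite lebesgue_cube ?(ltW rho0)// /vol expr0 mulr1.
have [y0 y0Q [Gy0 _]] : exists2 y0, Q0 y0 &
    (G y0 <= (3 * b / vol 0)%:E)%E /\ (G y0 <= (3 * b / vol 0)%:E)%E.
  apply: (@exists_pair_le_average _ _ _ (@lebesgue_rV R m)) => //.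
  - exact: measurable_funTS.
  - exact: measurable_funTS.
have half u : Q0 u -> l * `|f y0 0 i - f u 0 i| <=
    chain_cst m delta * (rho `^ delta * (1 + k)).
  move=> uQ; apply/ler_addgt0Pr => e e0.
  have el0 : 0 < e / l by rewrite divr_gt0.
  have cfi : (fun y => f y 0 i) @ u --> f u 0 i.
    exact: (continuous_coord_comp (i := i) cf).
  have /cvgrPdist_lt/(_ _ el0) := cfi; rewrite -nbhs_ballE => -[r /= r0 ru].
  have [n nr] : exists n, rho * 2^-1 ^+ n < r.
    have [n _ /(_ n (leqnn n))] := near_infty_natSinv_lt (PosNum (divr_gt0 r0 rho0)).
    rewrite /= => nr; exists n; rewrite mulrC -ltr_pdivlMr//; apply: le_lt_trans nr.
    rewrite exprVn lef_pV2 ?posrE ?exprn_gt0// -natrX ler_nat; exact: ltn_expl.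
  have [y [yQ _ fy]] := chain uQ y0Q Gy0 n.
  have yu : `|f u 0 i - f y 0 i| < e / l.
    apply: ru; split => // a1 j; rewrite ord1 /ball/=.
    by rewrite (le_lt_trans (Qn_dist uQ yQ j)).
  apply: (@le_trans _ _ (l * `|f y0 0 i - f y 0 i| + l * `|f y 0 i - f u 0 i|)).
    by rewrite -mulrDr; apply: (ler_wpM2l (ltW l0)); exact: ler_distD.
  apply: lerD; first exact: le_trans (fy i) (chain_sum_le n).
  by rewrite distrC mulrC -ler_pdivlMr// ltW.
move=> xQ x'Q.
apply: (@le_trans _ _ (l * `|f x 0 i - f y0 0 i| + l * `|f y0 0 i - f x' 0 i|)).
  by rewrite -mulrDr; apply: (ler_wpM2l (ltW l0)); exact: ler_distD.
have := half x xQ; have := half x' x'Q; rewrite (distrC (f x 0 i)); lra.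
Qed.

End chaining.

(** * Joint measurability and monotonicity of integrals *)
Section joint_measurability.
Context d (O : measurableType d) (R : realType) (m : nat).
Variable Z : 'rV[R]_m -> O -> R.
Hypothesis mZ : forall y, measurable_fun setT (Z y).
Hypothesis cZ : forall w, continuous (Z ^~ w).

Let grid (n : nat) (y : 'rV[R]_m) : 'rV[int]_m :=
  \row_l Num.floor (n.+1%:R * y 0 l).
Let node (n : nat) (j : 'rV[int]_m) : 'rV[R]_m := \row_l ((j 0 l)%:~R / n.+1%:R).

Let measurable_grid n j : measurable [set y | grid n y = j].
Proof.
rewrite (_ : mkset _ = \bigcap_(l in [set: 'I_m]) ((fun y : 'rV[R]_m => y 0 l) @^-1`
    `[(j 0 l)%:~R / n.+1%:R, (j 0 l + 1)%:~R / n.+1%:R[)); last first.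
  have n0 : (0 : R) < n.+1%:R by rewrite ltr0n.
  apply/seteqP; split => [y /= <- l _ /=|y yB].
    rewrite in_itv/= mxE ler_pdivrMr// ltr_pdivlMr// mulrC.
    exact: floor_itv.
  apply/rowP => l; rewrite mxE; have := yB l I; rewrite /= in_itv/=.
  rewrite ler_pdivrMr// ltr_pdivlMr// [_ * n.+1%:R]mulrC => h.
  exact: floor_def.
apply: fin_bigcap_measurable => // l _.
by rewrite -[X in measurable X]setTI; apply: measurable_coord => //; exact: measurable_itv.
Qed.

(** The process is the pointwise limit of its values at the nodes of finer and
finer grids, and these take countably many positions. *)
Lemma measurable_continuous_process :
  measurable_fun setT (fun p : 'rV[R]_m * O => Z p.1 p.2).
Proof.
apply: (@measurable_fun_cvg _ _ _ _ (fun n p => Z (node n (grid n p.1)) p.2)).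
  move=> n _ B mB; rewrite setTI.
  rewrite (_ : _ @^-1` _ = \bigcup_j ([set y | grid n y = j] `*` (Z (node n j) @^-1` B))).
    apply: countable_bigcupT_measurable => // j; apply: measurableX => //.
    by rewrite -[X in measurable X]setTI; exact: mZ.
  apply/seteqP; split => [[y w] /= ZB|[y w] [j _ [/= <-]]//].
  by exists (grid n y).
move=> [y w] _ /=.
apply: (@cvg_comp _ _ _ (fun n => node n (grid n y)) (Z ^~ w)); last exact: cZ.
apply/cvg_ballP => e e0; near=> n.
have n0 : (0 : R) < n.+1%:R by rewrite ltr0n.
split => // i l; rewrite ord1 /ball/= !mxE.
set a := n.+1%:R * y 0 l.
rewrite (_ : y 0 l - _ = (a - (Num.floor a)%:~R) / n.+1%:R); last first.
  by rewrite /a; field; rewrite gt_eqF.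
rewrite normrM ger0_norm ?subr_ge0 ?floor_le// gtr0_norm ?invr_gt0//.
have a1 : a - (Num.floor a)%:~R <= 1.
  by rewrite lerBlDl addrC; have /andP[_ /ltW] := floor_itv a; rewrite intrD addrC.
rewrite (@le_lt_trans _ _ (n.+1%:R^-1))//; first by rewrite ler_piMl// invr_ge0.
near: n; exact: (near_infty_natSinv_lt (PosNum e0)).
Unshelve. all: by end_near. Qed.

End joint_measurability.

Lemma measurable_exp_increment d (T : measurableType d) (R : realType) (m n : nat)
    (g g' : T -> 'rV[R]_n) (h h' : T -> 'rV[R]_m) (delta l : R) :
  (forall i, measurable_fun setT (fun t => g t 0 i)) ->
  (forall i, measurable_fun setT (fun t => g' t 0 i)) ->
  (forall i, measurable_fun setT (fun t => h t 0 i)) ->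
  (forall i, measurable_fun setT (fun t => h' t 0 i)) ->
  measurable_fun setT (fun t =>
    expR (l * (enorm (g t - g' t) / enorm (h t - h' t) `^ delta))).
Proof.
move=> mg mg' mh mh'.
apply: measurableT_comp => //; apply: measurable_funM => //; apply: measurable_funM.
  apply: measurable_enorm => i; under eq_fun do rewrite !mxE.
  exact: measurable_funB.
under eq_fun do rewrite -powRN.
apply: (@measurableT_comp _ _ _ _ _ _ (fun x : R => x `^ (- delta))).
  exact: measurable_powR.
by apply: measurable_enorm => i; under eq_fun do rewrite !mxE; exact: measurable_funB.
Qed.

(** The integral of a nonnegative function is the supremum of the integrals of
the simple functions below it, which is monotone for arbitrary functions. This
matters because the double integral in time of the original process need not be
measurable in w: its paths are arbitrary on a null set. *)
Lemma ge0_le_integral_nonmeasurable d (T : measurableType d) (R : realType)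
    (mu : {measure set T -> \bar R}) (f g : T -> \bar R) :
  (forall t, 0 <= f t)%E -> (forall t, f t <= g t)%E ->
  (\int[mu]_t f t <= \int[mu]_t g t)%E.
Proof.
move=> f0 fg; rewrite !ge0_integralTE//; last first.
  by move=> t; apply: le_trans (fg t).
apply: ereal_sup_le => _ [h /= hf <-]; exists h => //= t.
exact: le_trans (fg t).
Qed.

(** * Increments on the event that the process is near a point *)
Lemma enorm_le_sum (R : realType) n (x : 'rV[R]_n) : enorm x <= \sum_i `|x 0 i|.
Proof.
have S0 : 0 <= \sum_i `|x 0 i| by exact: sumr_ge0.
rewrite -[leRHS]ger0_norm// -sqrtr_sqr ler_wsqrtr// expr2 mulr_sumr.
apply: ler_sum => i _; rewrite -real_normK ?num_real// expr2 ler_wpM2r//.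
by rewrite (bigD1 i)//= lerDl sumr_ge0.
Qed.

Section increments.
Context d (O : measurableType d) (R : realType) (P : probability O R).
Context (m n : nat) (v : 'rV[R]_m -> 'I_n -> {RV P >-> R}).
Hypothesis n0 : (0 < n)%N.
Hypothesis hgauss : gaussian_family (fun p : 'rV[R]_m * 'I_n => v p.1 p.2).
Hypothesis hcent : forall x i, ('E_P[v x i] = 0)%E.
Hypothesis hindep : independent_processes (fun i x => v x i).

Let mv x i : measurable_fun setT (v x i).
Proof. exact: measurable_funPT. Qed.

Let gv x i : gaussian_variable P (v x i).
Proof.
have := hgauss (fun _ : 'I_1 => (x, i)) (fun=> 1).
by congr gaussian_variable; apply/funext => w; rewrite big_ord1 mul1r.
Qed.

Let Ev x i : \int[P]_w v x i w = 0.
Proof. by rewrite /Rintegral -expectation_def hcent. Qed.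

Let iv x i : P.-integrable setT (EFin \o v x i).
Proof. exact: gaussian_variable_integrable. Qed.

Let incr y y' i w := v y i w - v y' i w.

Let m_incr y y' i : measurable_fun setT (incr y y' i).
Proof. exact: measurable_funB. Qed.

Let g_incr x y y' i (a b : R) :
  gaussian_variable P (fun w => a * v x i w + b * incr y y' i w).
Proof.
pose j (k : 'I_3) := nth (x, i) [:: (x, i); (y, i); (y', i)] k.
pose c (k : 'I_3) := nth 0 [:: a; b; - b] k.
have := hgauss j c; congr gaussian_variable; apply/funext => w.
rewrite !big_ord_recl big_ord0 /c /= /incr; ring.
Qed.

Let E_incr y y' i : \int[P]_w incr y y' i w = 0.
Proof. by rewrite /incr RintegralB// !Ev subrr. Qed.

Let V y y' w := vector_value v w y - vector_value v w y'.

Let VE y y' w i : V y y' w 0 i = incr y y' i w.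
Proof. by rewrite /V /vector_value !mxE. Qed.

Let mV y y' : measurable_fun setT (fun w => enorm (V y y' w)).
Proof.
apply: measurable_enorm => i; under eq_fun do rewrite VE.
exact: m_incr.
Qed.

Let near_set (x : 'rV[R]_m) (z : 'rV[R]_n) (r : R) (w : O) : R :=
  \prod_i (`|v x i w - z 0 i| <= r)%R%:R.

(** Bounding the norm by the sum of the coordinates makes the weight a product
of functionals of the components, and each factor is controlled by
[gaussian_pair_density_abs]. With the factor 1 / sqrt n the exponents come out
as t i / n, and the product of the e^{t i / n} is a geometric mean of the
e^{t i}; each e^{t i} = E exp (s incr_i) is at most the right-hand expectation. *)
Lemma expectation_increment_near (x y y' : 'rV[R]_m) (z : 'rV[R]_n) (sg r s : R) :
  0 < sg -> (forall i, sg ^+ 2 <= second_moment P (v x i)) -> 0 < r -> 0 <= s ->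
  (\int[P]_w (expR ((Num.sqrt n%:R)^-1 * (enorm (V y y' w) * s)) *
      near_set x z r w)%:E <=
   ((2 * density_cst R * r / sg) ^+ n)%:E *
     \int[P]_w (expR (enorm (V y y' w) * s))%:E)%E.
Proof.
move=> sg0 sgv r0 s0.
set la := (Num.sqrt n%:R)^-1 * s.
have sn0 : 0 < Num.sqrt n%:R :> R by rewrite sqrtr_gt0 ltr0n.
have la0 : 0 <= la by rewrite mulr_ge0// invr_ge0 ltW.
have C0 := density_cst_gt0 R.
pose t i := s ^+ 2 * second_moment P (incr y y' i) / 2.
pose G (i : 'I_n) (g : path_space R 'rV[R]_m) : R :=
  expR (la * `|g y - g y'|) * (`|g x - z 0 i| <= r)%R%:R.
have step1 : (\int[P]_w (expR ((Num.sqrt n%:R)^-1 * (enorm (V y y' w) * s)) *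
      near_set x z r w)%:E <= \int[P]_w (\prod_i G i (fun t => v t i w))%:E)%E.
  apply: ge0_le_integral_nonmeasurable => w.
    by rewrite lee_fin mulr_ge0 ?expR_ge0// prodr_ge0.
  rewrite lee_fin /G big_split/= ler_wpM2r ?prodr_ge0//.
  rewrite -expR_sum ler_expR -mulr_sumr mulrA mulrAC -/la ler_wpM2l//.
  rewrite (le_trans (enorm_le_sum _))// ler_sum// => i _.
  by rewrite VE /incr lexx.
apply: (le_trans step1).
have step2 : (\int[P]_w (\prod_i G i (fun t => v t i w))%:E <=
    (\prod_i (2 * density_cst R * r / sg * expR (t i / n%:R)))%:E)%E.
  apply: (independent_expectation_prod_le hindep).
  - move=> i; apply: measurable_funM.
      apply: measurableT_comp => //; apply: measurable_funM => //.
      apply: measurableT_comp => //.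
      by apply: measurable_funB; exact: measurable_path_eval.
    apply: (@measurable_natb _ _ _ (fun g : path_space R 'rV[R]_m => `|g x - z 0 i| <= r)).
    apply: measurable_fun_ler => //; apply: measurableT_comp => //.
    by apply: measurable_funB => //; exact: measurable_path_eval.
  - by move=> i g; rewrite mulr_ge0// expR_ge0.
  - move=> i; rewrite /G.
    have X0 : 0 < second_moment P (v x i).
      by rewrite (lt_le_trans _ (sgv i))// exprn_gt0.
    apply: (le_trans (gaussian_pair_density_abs (mv x i) (m_incr y y' i)
      (g_incr x y y' i) (Ev x i) (E_incr y y' i) X0 (z 0 i) r0 la0)).
    rewrite lee_fin (_ : la ^+ 2 * _ / 2 = t i / n%:R); last first.
      rewrite /la /t exprMn exprVn sqr_sqrtr//; field.
      by rewrite pnatr_eq0 -lt0n.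
    rewrite [leLHS](_ : _ = 2 * density_cst R * r * expR (t i / n%:R) *
      (Num.sqrt (second_moment P (v x i)))^-1); last by ring.
    rewrite [leRHS](_ : _ = 2 * density_cst R * r * expR (t i / n%:R) * sg^-1); last by ring.
    rewrite ler_wpM2l//; first by rewrite !mulr_ge0 ?expR_ge0// ltW.
    rewrite lef_pV2 ?posrE ?sqrtr_gt0//.
    by rewrite -[leLHS]ger0_norm ?(ltW sg0)// -sqrtr_sqr ler_wsqrtr.
apply: (le_trans step2); rewrite big_split/= EFinM prodr_const card_ord.
have D0 : 0 <= 2 * density_cst R * r / sg by rewrite divr_ge0 ?ltW// !mulr_gt0.
apply: lee_wpmul2l; first by rewrite lee_fin exprn_ge0.
have M i : ((expR (t i))%:E <= \int[P]_w (expR (enorm (V y y' w) * s))%:E)%E.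
  rewrite /t -(centered_gaussian_mgf (m_incr y y' i) _ (E_incr y y' i)); last first.
    have := g_incr x y y' i 0 1; congr gaussian_variable.
    by apply/funext => w; ring.
  apply: ge0_le_integral_nonmeasurable => w; first by rewrite lee_fin expR_ge0.
  rewrite lee_fin ler_expR mulrC ler_wpM2r// -VE.
  by rewrite (le_trans (ler_norm _))// ler_coord_enorm.
move: M; set E := (\int[P]_w _)%E => M.
have [->|Efin] := eqVneq E +oo%E; first by rewrite leey.
have E1 := M (Ordinal n0).
have Er : E \is a fin_num.
  rewrite ge0_fin_numE ?lt_neqAle ?Efin ?leey//.
  by rewrite (le_trans _ E1)// lee_fin expR_ge0.
have fE0 : 0 < fine E.
  by rewrite -lte_fin fineK// (lt_le_trans _ E1)// lte_fin expR_gt0.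
rewrite -(fineK Er) lee_fin -expR_sum -[leRHS]lnK ?posrE// ler_expR.
rewrite -mulr_suml ler_pdivrMr ?ltr0n//.
rewrite mulr_natr (_ : _ *+ n = \sum_(i < n) ln (fine E)); last first.
  by rewrite sumr_const card_ord.
apply: ler_sum => i _; rewrite -ler_expR lnK ?posrE//.
by rewrite -lee_fin fineK.
Qed.
End increments.

(** * Expected roughness on the event that the process is near a point *)
Section tonelli3.
Context d1 d2 (O : measurableType d1) (Y : measurableType d2) (R : realType).
Variables (P : {sigma_finite_measure set O -> \bar R})
  (mu : {sigma_finite_measure set Y -> \bar R}).

Lemma tonelli3 (H : (O * Y) * Y -> \bar R) :
  measurable_fun setT H -> (forall p, 0 <= H p)%E ->
  (\int[P]_w \int[mu]_y \int[mu]_y' H ((w, y), y') =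
   \int[mu]_y \int[mu]_y' \int[P]_w H ((w, y), y'))%E.
Proof.
move=> mH H0.
rewrite (@fubini_tonelli _ _ _ _ _ P mu (fun q => \int[mu]_y' H (q, y'))%E); last 2 first.
- exact: (measurable_fun_fubini_tonelli_F H mH H0).
- by move=> q; exact: integral_ge0.
apply: eq_integral => y _.
rewrite (@fubini_tonelli _ _ _ _ _ P mu (fun q => H ((q.1, y), q.2)))//.
apply: measurableT_comp => //; apply: measurable_fun_pair => //.
exact: measurable_fun_pair.
Qed.

Lemma tonelli3_le (H1 H2 : (O * Y) * Y -> \bar R) (c : R) : 0 <= c ->
  measurable_fun setT H1 -> (forall p, 0 <= H1 p)%E ->
  measurable_fun setT H2 -> (forall p, 0 <= H2 p)%E ->
  (forall y y', \int[P]_w H1 ((w, y), y') <= c%:E * \int[P]_w H2 ((w, y), y'))%E ->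
  (\int[P]_w \int[mu]_y \int[mu]_y' H1 ((w, y), y') <=
   c%:E * \int[P]_w \int[mu]_y \int[mu]_y' H2 ((w, y), y'))%E.
Proof.
move=> c0 mH1 H10 mH2 H20 H12.
have mcH2 : measurable_fun setT (fun p => c%:E * H2 p)%E by exact: measurable_funeM.
have cH20 p : (0 <= c%:E * H2 p)%E by rewrite mule_ge0// lee_fin.
have msec (H : (O * Y) * Y -> \bar R) (mH : measurable_fun setT H) q :
    measurable_fun setT (fun y' => H (q, y')).
  exact: (measurableT_comp mH (measurable_pair1 q)).
have mF (H : (O * Y) * Y -> \bar R) (mH : measurable_fun setT H)
    (H0 : forall p, (0 <= H p)%E) :
    measurable_fun setT (fun q : O * Y => \int[mu]_y' H (q, y'))%E.
  exact: (measurable_fun_fubini_tonelli_F H mH H0).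
have -> : (c%:E * \int[P]_w \int[mu]_y \int[mu]_y' H2 ((w, y), y') =
    \int[P]_w \int[mu]_y \int[mu]_y' (c%:E * H2 ((w, y), y')))%E.
  rewrite -ge0_integralZl//; last 2 first.
  - exact: (measurable_fun_fubini_tonelli_F _ (mF _ mH2 H20)
      (fun q => integral_ge0 _ (fun y' _ => H20 (q, y')))).
  - by move=> w _; apply: integral_ge0 => y _; exact: integral_ge0.
  apply: eq_integral => w _; rewrite -ge0_integralZl//; last 2 first.
  - exact: (measurableT_comp (mF _ mH2 H20) (measurable_pair1 w)).
  - by move=> y _; exact: integral_ge0.
  by apply: eq_integral => y _; rewrite -ge0_integralZl//; exact: msec.
rewrite (tonelli3 mH1 H10) (tonelli3 mcH2 cH20).
apply: ge0_le_integral_nonmeasurable => y.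
  by apply: integral_ge0 => y' _; exact: integral_ge0.
apply: ge0_le_integral_nonmeasurable => y'; first exact: integral_ge0.
rewrite ge0_integralZl//.
apply: (measurableT_comp mH2); apply: measurable_fun_pair => //.
Qed.
End tonelli3.

Section rough_event.
Context d (O : measurableType d) (R : realType) (P : probability O R).
Context (m n : nat) (v : 'rV[R]_m -> 'I_n -> {RV P >-> R}).
Hypothesis n0 : (0 < n)%N.
Hypothesis hgauss : gaussian_family (fun p : 'rV[R]_m * 'I_n => v p.1 p.2).
Hypothesis hcent : forall x i, ('E_P[v x i] = 0)%E.
Hypothesis hindep : independent_processes (fun i x => v x i).
Variable N : set O.
Hypotheses (mN : measurable N) (PN : P N = 0%E).
Hypothesis cN : forall w, ~ N w -> continuous (vector_value v w).

(** All paths of this version are continuous, which joint measurability needs;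
it agrees with the process off the null set N. *)
Definition modification (w : O) : 'rV[R]_m -> 'rV[R]_n :=
  if w \in N then cst 0 else vector_value v w.
Local Notation u := modification.

Lemma modificationE w : ~ N w -> u w = vector_value v w.
Proof. by move=> Nw; rewrite /u memNset. Qed.

Lemma continuous_modification w : continuous (u w).
Proof.
rewrite /u; case: ifPn => [_|/negP wN]; first exact: cst_continuous.
by apply: cN => Nw; apply: wN; rewrite inE.
Qed.

Lemma measurable_modification i :
  measurable_fun setT (fun p : 'rV[R]_m * O => u p.2 p.1 0 i).
Proof.
apply: (@measurable_continuous_process _ _ _ _ (fun y w => u w y 0 i)).
  move=> y; rewrite (_ : (fun _ => _) = (fun w => v y i w * \1_(~` N) w)).
    apply: measurable_funM; first exact: measurable_funPT.
    by apply: measurable_indic; exact: measurableC.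
  apply/funext => w; rewrite /u indicE in_setC.
  by case: (w \in N); rewrite /= ?mxE ?mulr0 ?mulr1.
by move=> w; exact: (continuous_coord_comp (i := i) (@continuous_modification w)).
Qed.

Variables (delta : R) (Q : set 'rV[R]_m).
Hypothesis mQ : measurable Q.

Definition roughness (l : R) (w : O) : \bar R :=
  (\int[@lebesgue_rV R m]_(y in Q) \int[@lebesgue_rV R m]_(y' in Q)
     (exp_increment (u w) delta l y y')%:E)%E.

Let H (l : R) (p : (O * 'rV[R]_m) * 'rV[R]_m) : \bar R :=
  (exp_increment (u p.1.1) delta l p.1.2 p.2 * (\1_Q p.1.2 * \1_Q p.2))%:E.

Let H0 l p : (0 <= H l p)%E.
Proof. by rewrite lee_fin mulr_ge0 ?expR_ge0// mulr_ge0. Qed.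

Let mI : measurable_fun setT (\1_Q : 'rV[R]_m -> R).
Proof. exact: measurable_indic. Qed.

Let mH l : measurable_fun setT (H l).
Proof.
apply/measurable_EFinP; apply: measurable_funM; last first.
  apply: measurable_funM.
    exact: (measurableT_comp mI (measurableT_comp measurable_snd measurable_fst)).
  exact: (measurableT_comp mI measurable_snd).
apply: measurable_exp_increment => i.
- apply: (measurableT_comp (measurable_modification i) (g := fun p => (p.1.2, p.1.1))).
  apply: measurable_fun_pair; first exact: (measurableT_comp measurable_snd measurable_fst).
  exact: (measurableT_comp measurable_fst measurable_fst).
- apply: (measurableT_comp (measurable_modification i) (g := fun p => (p.2, p.1.1))).
  apply: measurable_fun_pair; first exact: measurable_snd.
  exact: (measurableT_comp measurable_fst measurable_fst).
- exact: (measurableT_comp (measurable_coord i) (measurableT_comp measurable_snd measurable_fst)).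
- exact: (measurableT_comp (measurable_coord i) measurable_snd).
Qed.

Lemma roughnessE l w : roughness l w =
  (\int[@lebesgue_rV R m]_y \int[@lebesgue_rV R m]_y' H l ((w, y), y'))%E.
Proof.
rewrite /roughness integral_mkcond; apply: eq_integral => y _.
rewrite patchE /H /=; case: ifPn => yQ; last first.
  under eq_integral do rewrite indicE (negbTE yQ) mul0r mulr0.
  by rewrite integral0.
rewrite integral_mkcond; apply: eq_integral => y' _.
rewrite patchE !indicE yQ mul1r; case: ifPn => _; by rewrite ?mulr1 ?mulr0.
Qed.

Lemma measurable_roughness l : measurable_fun setT (roughness l).
Proof.
rewrite (_ : roughness l = (fun w => \int[@lebesgue_rV R m]_y
    \int[@lebesgue_rV R m]_y' H l ((w, y), y'))%E); last first.
  by apply/funext => w; exact: roughnessE.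
have mF : measurable_fun setT (fun q : O * 'rV[R]_m =>
    \int[@lebesgue_rV R m]_y' H l (q, y'))%E.
  exact: (measurable_fun_fubini_tonelli_F (H l) (mH l) (H0 l)).
exact: (measurable_fun_fubini_tonelli_F _ mF
  (fun q => integral_ge0 _ (fun y' _ => H0 l (q, y')))).
Qed.

Lemma roughness_ge0 l w : (0 <= roughness l w)%E.
Proof.
by apply: integral_ge0 => y _; apply: integral_ge0 => y' _; rewrite lee_fin expR_ge0.
Qed.

Let eq_integral_off (f g : O -> \bar R) :
  measurable_fun setT f -> measurable_fun setT g ->
  (forall w, ~ N w -> f w = g w) -> (\int[P]_w f w = \int[P]_w g w)%E.
Proof.
move=> mf mg fg; apply: ae_eq_integral => //.
exists N; split => // w /= h; apply: contrapT => /fg fgw; exact: h.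
Qed.

Let near_set (x : 'rV[R]_m) (z : 'rV[R]_n) (r : R) (w : O) : R :=
  \prod_i (`|u w x 0 i - z 0 i| <= r)%R%:R.

Let near_set_ge0 x z r w : 0 <= near_set x z r w.
Proof. exact: prodr_ge0. Qed.

Let mu_ x i : measurable_fun setT (fun w => u w x 0 i).
Proof. exact: (measurableT_comp (measurable_modification i) (measurable_pair1 x)). Qed.

Let m_near x z r : measurable_fun setT (near_set x z r).
Proof.
apply: measurable_prod => i _.
apply: (@measurable_natb _ _ _ (fun w => `|u w x 0 i - z 0 i| <= r)).
by apply: measurable_fun_ler => //; apply: measurableT_comp => //; apply: measurable_funB.
Qed.

Local Notation l := ((Num.sqrt n%:R)^-1 : R).

(** By Tonelli it suffices to compare the integrands at fixed y and y', where
the modification may be replaced by the process itself, almost surely. *)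
Lemma expectation_roughness_near (x : 'rV[R]_m) (z : 'rV[R]_n) (sg r : R) :
  0 < sg -> (forall i, sg ^+ 2 <= second_moment P (v x i)) -> 0 < r ->
  (\int[P]_w ((near_set x z r w)%:E * roughness l w) <=
   ((2 * density_cst R * r / sg) ^+ n)%:E * \int[P]_w roughness 1 w)%E.
Proof.
move=> sg0 sgv r0.
pose H1 p := ((near_set x z r p.1.1)%:E * H l p)%E.
have mH1 : measurable_fun setT H1.
  apply: emeasurable_funM; last exact: mH.
  apply/measurable_EFinP.
  exact: (measurableT_comp (m_near x z r) (measurableT_comp measurable_fst measurable_fst)).
have H10 p : (0 <= H1 p)%E by rewrite mule_ge0// lee_fin.
have msec w q : measurable_fun setT (fun y' => H l ((w, q), y')).
  exact: (measurableT_comp (mH l) (measurable_pair1 (w, q))).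
have mF w : measurable_fun setT (fun y =>
    \int[@lebesgue_rV R m]_y' H l ((w, y), y'))%E.
  exact: (measurableT_comp (measurable_fun_fubini_tonelli_F (H l) (mH l) (H0 l))
    (measurable_pair1 w)).
rewrite (_ : (\int[P]_w _)%E = (\int[P]_w \int[@lebesgue_rV R m]_y
    \int[@lebesgue_rV R m]_y' H1 ((w, y), y'))%E); last first.
  apply: eq_integral => w _; rewrite roughnessE /H1/= -ge0_integralZl//; last 2 first.
  - by move=> y _; exact: integral_ge0.
  - by rewrite lee_fin.
  apply: eq_integral => y _; rewrite -ge0_integralZl//; by rewrite lee_fin.
rewrite [X in (_ * X)%E](_ : _ = (\int[P]_w \int[@lebesgue_rV R m]_y
    \int[@lebesgue_rV R m]_y' H 1 ((w, y), y'))%E); last first.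
  by apply: eq_integral => w _; rewrite roughnessE.
have C0 := density_cst_gt0 R.
have A0 : 0 <= (2 * density_cst R * r / sg) ^+ n.
  by rewrite exprn_ge0// divr_ge0 ?ltW// !mulr_gt0.
apply: (@tonelli3_le _ _ _ _ _ P (@lebesgue_rV R m) _ _ _ A0 mH1 H10 (mH 1) (@H0 1)) => y y'.
have [yQ|yQ] := boolP ((y \in Q) && (y' \in Q)); last first.
  rewrite (_ : (\int[P]_w _)%E = 0%E); last first.
    apply: integral0_eq => w _; rewrite /H1 /H /= !indicE.
    by move: yQ; rewrite negb_and => /orP[]/negbTE ->; rewrite ?(mulr0, mul0r, mule0).
  by rewrite mule_ge0//; exact: integral_ge0.
have {yQ}[yQ y'Q] := andP yQ.
pose s : R := (enorm (y - y') `^ delta)^-1.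
have s0 : 0 <= s by rewrite invr_ge0 powR_ge0.
have msv : measurable_fun setT (fun w => enorm (vector_value v w y - vector_value v w y')).
  apply: measurable_enorm => i; under eq_fun do rewrite !mxE.
  by apply: measurable_funB; exact: measurable_funPT.
have mnv : measurable_fun setT (fun w => \prod_i (`|v x i w - z 0 i| <= r)%R%:R : R).
  apply: measurable_prod => i _.
  apply: (@measurable_natb _ _ _ (fun w => `|v x i w - z 0 i| <= r)).
  have mvxi : measurable_fun setT (v x i) by exact: measurable_funPT.
  by apply: measurable_fun_ler => //; apply: measurableT_comp => //; apply: measurable_funB.
have msecw (G : (O * 'rV[R]_m) * 'rV[R]_m -> \bar R) :
    measurable_fun setT G -> measurable_fun setT (fun w => G ((w, y), y')).
  move=> mG; apply: (measurableT_comp mG); apply: measurable_fun_pair => //.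
rewrite (@eq_integral_off _ (fun w => (expR (l * (enorm (vector_value v w y -
    vector_value v w y') * s)) * \prod_i (`|v x i w - z 0 i| <= r)%R%:R)%:E)); first last.
- move=> w Nw; rewrite /H1 /H /= !indicE yQ y'Q !mulr1 -EFinM /exp_increment
    modificationE// mulrC; congr (_ * _)%:E.
  by rewrite /near_set; apply: eq_bigr => i _; rewrite modificationE// mxE.
- apply/measurable_EFinP; apply: measurable_funM => //; apply: measurableT_comp => //.
  by apply: measurable_funM => //; exact: measurable_funM.
- exact: (msecw _ mH1).
rewrite [X in (_ * X)%E](@eq_integral_off _ (fun w => (expR (enorm (vector_value v w y -
    vector_value v w y') * s))%:E)); first last.
- by move=> w Nw; rewrite /H /= !indicE yQ y'Q !mulr1 /exp_increment modificationE// mul1r.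
- by apply/measurable_EFinP; apply: measurableT_comp => //; exact: measurable_funM.
- exact: (msecw _ (mH 1)).
exact: expectation_increment_near.
Qed.

(** Multiplying the roughness by the indicator of the complement of N leaves its
expectation unchanged and puts it below the double integral of the original
process at every w. *)
Lemma expectation_modified_roughness_le (c : \bar R) :
  (\int[P]_w \int[@lebesgue_rV R m]_(y in Q) \int[@lebesgue_rV R m]_(y' in Q)
     (expR (enorm (vector_value v w y - vector_value v w y') /
        enorm (y - y') `^ delta))%:E <= c)%E ->
  (\int[P]_w roughness 1 w <= c)%E.
Proof.
apply: le_trans.
pose g w := (roughness 1 w * (\1_(~` N) w)%:E)%E.
apply: (@le_trans _ _ (\int[P]_w g w)%E).
  rewrite le_eqVlt; apply/orP; left; apply/eqP; apply: eq_integral_off.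
  - exact: measurable_roughness.
  - apply: emeasurable_funM; first exact: measurable_roughness.
    by apply/measurable_EFinP; apply: measurable_indic; exact: measurableC.
  - by move=> w Nw; rewrite /g indicE mem_set// mule1.
apply: ge0_le_integral_nonmeasurable => w; rewrite /g.
  by rewrite mule_ge0 ?roughness_ge0// lee_fin.
rewrite indicE; have [wN|/negP wN] := boolP (w \in N).
  rewrite in_setC wN mule0; apply: integral_ge0 => y _; apply: integral_ge0 => y' _.
  by rewrite lee_fin expR_ge0.
have Nw : ~ N w by move=> ?; apply: wN; rewrite inE.
rewrite mem_set// mule1 /roughness le_eqVlt; apply/orP; left; apply/eqP.
apply: eq_integral => y _; apply: eq_integral => y' _.
by rewrite /exp_increment modificationE// mul1r.
Qed.

Definition near_rough (x : 'rV[R]_m) (z : 'rV[R]_n) (r b : R) : set O :=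
  [set w | (forall i, `|u w x 0 i - z 0 i| <= r) /\ (b%:E <= roughness l w)%E].

Lemma measurable_near_rough x z r b : measurable (near_rough x z r b).
Proof.
rewrite (_ : near_rough x z r b =
    (\bigcap_(i in [set: 'I_n]) [set w | `|u w x 0 i - z 0 i| <= r]) `&`
    [set w | (b%:E <= roughness l w)%E]); last first.
  by apply/seteqP; split => w [h1 h2]; split => // i; [move=> _; exact: h1|exact: h1].
apply: measurableI.
  apply: fin_bigcap_measurable => // i _.
  have := @measurable_fun_le _ _ _ setT (fun w => `|u w x 0 i - z 0 i|) (cst r) measurableT.
  rewrite setTI; apply => //; apply: measurableT_comp => //; exact: measurable_funB.
rewrite -[X in measurable X]setTI; apply: measurable_lee => //.
exact: measurable_roughness.
Qed.

(** Markov's inequality for the roughness restricted to the event that V x is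
near z. *)
Lemma near_rough_le (x : 'rV[R]_m) (z : 'rV[R]_n) (sg r b c : R) :
  0 < sg -> (forall i, sg ^+ 2 <= second_moment P (v x i)) -> 0 < r -> 0 < b ->
  (\int[P]_w roughness 1 w <= c%:E)%E ->
  (P (near_rough x z r b) <= ((2 * density_cst R * r / sg) ^+ n * c / b)%:E)%E.
Proof.
move=> sg0 sgv r0 b0 hc.
have C0 := density_cst_gt0 R.
have A0 : 0 <= (2 * density_cst R * r / sg) ^+ n.
  by rewrite exprn_ge0// divr_ge0 ?ltW// !mulr_gt0.
rewrite EFinM lee_pdivlMr// EFinM.
apply: le_trans (lee_wpmul2l _ hc); last by rewrite lee_fin.
apply: le_trans (expectation_roughness_near z sg0 sgv r0).
rewrite muleC -[P _]/(P _) -(setIT (near_rough x z r b)) -integral_indic//; last first.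
  exact: measurable_near_rough.
rewrite -ge0_integralZl//; first last.
- by rewrite lee_fin ltW.
- apply/measurable_EFinP; apply: measurable_indic; exact: measurable_near_rough.
apply: ge0_le_integral_nonmeasurable => w.
  by rewrite mule_ge0// lee_fin// ltW.
rewrite indicE; have [wN|wN] := boolP (w \in _); last first.
  by rewrite mule0 mule_ge0 ?roughness_ge0// lee_fin.
move: wN; rewrite inE => -[h1 h2]; rewrite mule1 /near_set big1 ?mul1e//.
by move=> i _; rewrite h1.
Qed.

End rough_event.

(** * Hitting a ball on one box *)
(** From t^d / d! <= e^t with t = (k + 2) / 2: half of the exponential decay
absorbs the power. *)
Lemma pow_succ2_expR_le (R : realType) (d k : nat) :
  (k.+2%:R ^+ d * expR (- k%:R) : R) <=
  2 ^+ d * d`!%:R * expR 1 * expR (- (1/2)) ^+ k.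
Proof.
have h : (k.+2%:R / 2) ^+ d / d`!%:R <= expR (k.+2%:R / 2) :> R.
  set x := k.+2%:R / 2; have x0 : 0 <= x by rewrite divr_ge0.
  apply: le_trans (nondecreasing_cvgn_le _ (is_cvg_series_exp_coeff x) d.+1); last first.
    by apply: nondecreasing_series => j _ _; rewrite /exp_coeff/= divr_ge0// exprn_ge0.
  rewrite seriesSr /exp_coeff/= lerDr seriesEnat/= sumr_ge0// => j _.
  by rewrite divr_ge0// exprn_ge0.
have E : k.+2%:R ^+ d <= 2 ^+ d * d`!%:R * expR (k.+2%:R / 2) :> R.
  move: h; rewrite ler_pdivrMr ?ltr0n ?fact_gt0// => h.
  rewrite [X in X ^+ d](_ : _ = 2 * (k.+2%:R / 2)); last by rewrite mulrC divfK.
  rewrite exprMn -mulrA; apply: ler_wpM2l; first by rewrite exprn_ge0.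
  by rewrite [leRHS]mulrC.
apply: (le_trans (ler_wpM2r (expR_ge0 _) E)).
rewrite -!mulrA ler_wpM2l ?exprn_ge0// ler_wpM2l//.
rewrite -expRD -expRM_natl -expRD ler_expR -addn2 natrD; lra.
Qed.

Lemma nneseries_geometric_le (R : realType) (a q : R) (f : nat -> \bar R) :
  0 <= a -> 0 < q < 1 -> (forall k, 0 <= f k)%E ->
  (forall k, f k <= (a * q ^+ k)%:E)%E ->
  (\sum_(0 <= k <oo) f k <= (a / (1 - q))%:E)%E.
Proof.
move=> a0 /andP[q0 q1] f0 fa; apply: lime_le; first exact: is_cvg_nneseries.
apply: nearW => n; apply: (@le_trans _ _ (\sum_(0 <= k < n) (a * q ^+ k)%:E)).
  by apply: lee_sum.
rewrite sumEFin lee_fin.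
have := @geometric_le_lim R n a q a0 q0; rewrite gtr0_norm// => /(_ q1).
by rewrite /series/=.
Qed.

Lemma outer_prob_le_series d (O : measurableType d) (R : realType)
    (P : probability O R) (S : set O) (F : nat -> set O) :
  (forall k, measurable (F k)) -> S `<=` \bigcup_k F k ->
  (outer_prob P S <= \sum_(0 <= k <oo) P (F k))%E.
Proof.
move=> mF SF; apply: le_trans (le_outer_measure _ _ _ SF) _.
apply: le_trans (outer_measure_sigma_subadditive _ _) _.
apply: lee_nneseries => k _ //.
by rewrite /= measurable_mu_extE.
Qed.

Section variance.
Context d (O : measurableType d) (R : realType) (P : probability O R).
Context (m n : nat) (v : 'rV[R]_m -> 'I_n -> {RV P >-> R}).
Hypothesis hcent : forall x i, ('E_P[v x i] = 0)%E.
Hypothesis hident : identically_distributed_processes (fun i x => v x i).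

Lemma variance_second_moment x i :
  'V_P[v x i] = (\int[P]_w ((v x i w) ^+ 2)%:E)%E.
Proof.
rewrite /variance covariance.unlock hcent expectation.unlock.
by apply: eq_integral => w _; rewrite expr2; congr (_ * _)%:E; exact: subr0.
Qed.

Lemma second_moment_ident x i j :
  (\int[P]_w ((v x i w) ^+ 2)%:E = \int[P]_w ((v x j w) ^+ 2)%:E)%E.
Proof.
have msq : measurable_fun setT (fun y : R => (y ^+ 2)%:E).
  by apply/measurable_EFinP; exact: exprn_measurable.
have pf k : (\int[P]_w ((v x k w) ^+ 2)%:E =
    \int[distribution P (v x k)]_y (y ^+ 2)%:E)%E.
  rewrite ge0_integral_distribution// => y; by rewrite lee_fin sqr_ge0.
rewrite !pf; apply: eq_measure_integral => B mB _.
have := hident i j; move=> /(_ [set g | B (g x)]); apply.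
by apply: sub_sigma_algebra; exists x, B.
Qed.

End variance.

Lemma grid_boxE (R : realType) (m : nat) (delta eps : R) (j : 'rV[int]_m) :
  grid_box delta eps j =
  cube (\row_l ((j 0 l)%:~R * eps `^ delta^-1)) (eps `^ delta^-1).
Proof.
by apply/seteqP; split => x xB l; have := xB l; rewrite !mxE intrD mulrDl mul1r.
Qed.

Lemma square_volume_le (R : realType) (m : nat) (a : 'rV[R]_m) (s : R)
    (F : 'rV[R]_m -> 'rV[R]_m -> R) : 0 <= s -> (forall y y', 1 <= F y y') ->
  ((s ^+ (2 * m))%:E <= \int[@lebesgue_rV R m]_(y in cube a s)
     \int[@lebesgue_rV R m]_(y' in cube a s) (F y y')%:E)%E.
Proof.
move=> s0 F1; have mQ := @measurable_cube R m a s.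
rewrite (_ : (s ^+ (2 * m))%:E = \int[@lebesgue_rV R m]_(y in cube a s)
   \int[@lebesgue_rV R m]_(y' in cube a s) 1)%E; last first.
  have E : (\int[@lebesgue_rV R m]_(y' in cube a s) 1 = (s ^+ m)%:E)%E.
    rewrite integral_cst// mul1e; exact: lebesgue_cube.
  under eq_integral do rewrite E.
  rewrite integral_cst// [X in (_ * X)%E](lebesgue_cube a s0) -EFinM.
  by rewrite mul2n -addnn exprD.
rewrite [leLHS]integral_mkcond [leRHS]integral_mkcond.
apply: ge0_le_integral_nonmeasurable => y; rewrite !patchE; case: ifPn => // _.
  exact: integral_ge0.
rewrite [leLHS]integral_mkcond [leRHS]integral_mkcond.
apply: ge0_le_integral_nonmeasurable => y'; rewrite !patchE; case: ifPn => // _.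
by rewrite lee_fin.
Qed.

Section hitting_box.
Context d (O : measurableType d) (R : realType) (P : probability O R).
Context (m n : nat) (v : 'rV[R]_m -> 'I_n -> {RV P >-> R}).
Hypothesis n0 : (0 < n)%N.
Hypothesis hgauss : gaussian_family (fun p : 'rV[R]_m * 'I_n => v p.1 p.2).
Hypothesis hcent : forall x i, ('E_P[v x i] = 0)%E.
Hypothesis hindep : independent_processes (fun i x => v x i).
Hypothesis hcont : {ae P, forall w, continuous (vector_value v w)}.
Variable delta : R.
Hypothesis delta0 : 0 < delta.

Let l : R := (Num.sqrt n%:R)^-1.
Let l0 : 0 < l. Proof. by rewrite invr_gt0 sqrtr_gt0 ltr0n. Qed.

(* D rho^delta (1 + k) bounds the oscillation of a coordinate over a cube of side
   rho when its roughness is at most e^k rho^(2m). *)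
Let D : R := 2 * chain_cst m delta / l.
Let D0 : 0 <= D.
Proof. by rewrite divr_ge0 ?(ltW l0)// mulr_ge0// chain_cst_ge0. Qed.

Definition hitting_cst (sg c : R) : R :=
  (2 * density_cst R * (D + 1) / sg) ^+ n * c * (2 ^+ n * n`!%:R * expR 1) /
  (1 - expR (- (1/2))).

Lemma hitting_cst_ge0 (sg c : R) : 0 < sg -> 0 <= c -> 0 <= hitting_cst sg c.
Proof.
move=> sg0 c0.
have C0 := ltW (density_cst_gt0 R).
apply: divr_ge0; last by rewrite subr_ge0 -[X in _ <= X]expR0 ler_expR; lra.
rewrite !mulr_ge0 ?exprn_ge0 ?expR_ge0//.
by rewrite divr_ge0 ?(ltW sg0)// !mulr_ge0// addr_ge0.
Qed.

(** On the hitting event, let k be the least index with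
|v_i x - z_i| <= r k for all i. If the roughness were below b k with k > 0,
chaining would give this already for r (k - 1). The probabilities of the
resulting events decay geometrically in k. *)
Lemma hitting_box_le (a x : 'rV[R]_m) (z : 'rV[R]_n) (rho sg c : R) :
  0 < rho -> 0 < sg -> 0 <= c -> cube a rho x ->
  (forall i, sg ^+ 2 <= second_moment P (v x i)) ->
  (\int[P]_w \int[@lebesgue_rV R m]_(y in cube a rho)
     \int[@lebesgue_rV R m]_(y' in cube a rho)
     (expR (enorm (vector_value v w y - vector_value v w y') /
        enorm (y - y') `^ delta))%:E <= (c * rho ^+ (2 * m))%:E)%E ->
  (outer_prob P (hits v (cube a rho) (eball z (rho `^ delta))) <=
    (hitting_cst sg c * (rho `^ delta) ^+ n)%:E)%E.
Proof.
move=> rho0 sg0 c0 xQ sgv hint.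
have [N [mN PN cN']] := hcont.
have cN w : ~ N w -> continuous (vector_value v w).
  by move=> Nw; apply: contrapT => /cN'.
pose u := modification v N.
set Q := cube a rho in xQ hint *.
have mQ : measurable Q by exact: measurable_cube.
set eps := rho `^ delta; have eps0 : 0 < eps by rewrite powR_gt0.
have C0 := density_cst_gt0 R.
pose r (k : nat) : R := (D + 1) * eps * k.+2%:R.
pose b (k : nat) : R := expR k%:R * rho ^+ (2 * m).
have D1 : 0 < D + 1 by rewrite ltr_wpDl.
have r0 k : 0 < r k by rewrite !mulr_gt0.
have b0 k : 0 < b k by rewrite mulr_gt0 ?expR_gt0// exprn_gt0.
(* the null set N is included in each event, at no cost in probability *)
pose F k := N `|` near_rough v N delta Q x z (r k) (b k).
have mNR k : measurable (near_rough v N delta Q x z (r k) (b k)).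
  exact: measurable_near_rough.
have mF k : measurable (F k) by exact: measurableU.
have rough1 := expectation_modified_roughness_le mN PN cN mQ hint.
have q01 : 0 < expR (- (1/2) : R) < 1.
  by rewrite expR_gt0 /= -[X in _ < X]expR0 ltr_expR; lra.
have PF k : (P (F k) <= ((2 * density_cst R * (D + 1) / sg) ^+ n * c *
    (2 ^+ n * n`!%:R * expR 1) * eps ^+ n * expR (- (1/2)) ^+ k)%:E)%E.
  rewrite /F setUC measureU0//.
  apply: le_trans (near_rough_le n0 hgauss hcent hindep mN PN cN mQ z sg0 sgv (r0 k) (b0 k) rough1) _.
  rewrite lee_fin.
  set A := (2 * density_cst R * (D + 1) / sg) ^+ n.
  have A0 : 0 <= A by rewrite exprn_ge0// divr_ge0 ?(ltW sg0)// !mulr_ge0// ltW.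
  rewrite [leLHS](_ : _ = A * c * eps ^+ n * (k.+2%:R ^+ n * expR (- k%:R))); last first.
    rewrite /b expRN (_ : _ / sg = 2 * density_cst R * (D + 1) / sg * eps * k.+2%:R).
      rewrite [(_ * eps * _) ^+ n]exprMn [(_ * eps) ^+ n]exprMn -/A; field.
      by rewrite expf_neq0 ?gt_eqF ?expR_gt0.
    by rewrite /r; ring.
  rewrite [leRHS](_ : _ = A * c * eps ^+ n * (2 ^+ n * n`!%:R * expR 1 *
    expR (- (1/2)) ^+ k)); last by ring.
  apply: ler_wpM2l; last exact: pow_succ2_expR_le.
  by rewrite !mulr_ge0// exprn_ge0// ltW.
have mF_u w : measurable_fun setT (fun p : 'rV[R]_m * 'rV[R]_m =>
    exp_increment (u w) delta l p.1 p.2).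
  apply: measurable_exp_increment => i.
  - exact: (measurableT_comp (measurableT_comp (measurable_modification mN cN i)
      (measurable_pair2 w)) measurable_fst).
  - exact: (measurableT_comp (measurableT_comp (measurable_modification mN cN i)
      (measurable_pair2 w)) measurable_snd).
  - exact: (measurableT_comp (measurable_coord i) measurable_fst).
  - exact: (measurableT_comp (measurable_coord i) measurable_snd).
have cover : hits v Q (eball z eps) `<=` \bigcup_k F k.
  move=> w [_ [[y yQ <-] yz]].
  have [wN|wN] := pselect (N w); first by exists 0%N => //; left.
  pose p k := [forall i, `|u w x 0 i - z 0 i| <= r k].
  have exp_ : exists k, p k.
    exists (\max_(i < n) Num.truncn (`|u w x 0 i - z 0 i| / ((D + 1) * eps))%R)%N.
    apply/forallP => i; rewrite /r mulrC -ler_pdivrMr ?mulr_gt0//.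
    rewrite (le_trans (ltW (truncnS_gt _)))// ler_nat ltnS.
    by apply: leqW; rewrite (leq_bigmax i).
  case: (ex_minnP exp_) => k /forallP pk kmin; exists k => //; right; split => //.
  (* k = 0: the integrand is at least 1, so every path has roughness >= b 0 *)
  case: k pk kmin => [|k] pk kmin.
    rewrite /b expR0 mul1r; apply: square_volume_le; first exact: ltW.
    move=> y1 y2; rewrite -expR0 ler_expR mulr_ge0 ?(ltW l0)// divr_ge0 ?enorm_ge0//.
    exact: powR_ge0.
  rewrite leNgt; apply/negP => /ltW rough.
  have /forallPn[i] : ~~ p k by apply/negP => /kmin; rewrite ltnn.
  rewrite -ltNge; apply/negP; rewrite -leNgt.
  have osc := chaining_oscillation delta0 l0 (@continuous_modification _ _ _ _ _ _ _ _ cN w)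
    (mF_u w) rho0 (ler0n R k.+1) rough i xQ yQ.
  have zy : `|u w y 0 i - z 0 i| <= eps.
    rewrite /u modificationE//; apply: le_trans (ltW yz).
    by have := ler_coord_enorm (vector_value v w y - z) i; rewrite !mxE.
  have {}osc : `|u w x 0 i - u w y 0 i| <= D * eps * k.+2%:R.
    rewrite -(ler_pM2l l0) (le_trans osc)// /D.
    rewrite [leRHS](_ : _ = 2 * chain_cst m delta * (eps * k.+2%:R)).
      by rewrite -nat1r.
    by field; rewrite gt_eqF.
  apply: (le_trans (ler_distD (u w y 0 i) _ _)).
  apply: (le_trans (lerD osc zy)).
  have : 1 <= k.+2%:R :> R by rewrite ler1n.
  rewrite /r; nra.
apply: (le_trans (@outer_prob_le_series _ _ _ P _ _ mF cover)).
rewrite /hitting_cst mulrAC; apply: nneseries_geometric_le => //.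
rewrite !mulr_ge0 ?exprn_ge0 ?expR_ge0 ?(ltW eps0)//.
by rewrite divr_ge0 ?(ltW sg0)// !mulr_ge0// ltW.
Qed.
End hitting_box.

(** * From boxes to Hausdorff measure *)
Lemma compact_coord_bounded (R : realType) (m : nat) (I : set 'rV[R]_m) :
  compact I -> exists2 M : R, 0 < M & forall x, I x -> forall l, `|x 0 l| <= M.
Proof.
move=> cI; have [M M0 IM] := pinfty_ex_gt0 (compact_bounded cI).
exists M => // x Ix l; apply: le_trans (IM x Ix).
have -> : `|x| = mx_norm x by [].
rewrite mx_normrE.
exact: (@le_bigmax _ _ _ 0 (fun ij : 'I_1 * 'I_m => `|x ij.1 ij.2|) (0, l)).
Qed.

Lemma outer_measure_bigcup_le (R : realType) (T : Type) (K : Type)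
    (mu : {outer_measure set T -> \bar R}) (s : seq K) (F : K -> set T) :
  (mu (\big[setU/set0]_(k <- s) F k) <= \sum_(k <- s) mu (F k))%E.
Proof.
elim: s => [|k s IH]; first by rewrite !big_nil outer_measure0.
rewrite !big_cons (le_trans (outer_measureU2 _ _ _))//; exact: leeD.
Qed.

Section hausdorff_covering.
Context d (O : measurableType d) (R : realType) (P : probability O R).
Context (m n : nat) (v : 'rV[R]_m -> 'I_n -> {RV P >-> R}).
Variables (I : set 'rV[R]_m) (M delta C : R).
Hypotheses (M0 : 0 < M) (IM : forall x, I x -> forall l, `|x 0 l| <= M).
Hypotheses (delta0 : 0 < delta) (C0 : 0 <= C).

Lemma outer_prob0 : outer_prob P set0 = 0%E.
Proof. exact: outer_measure0. Qed.

(** The (2K)^m grid boxes with K about M eps^{-1/delta} cover I; those which do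
not meet I contribute nothing. *)
Lemma hits_ball_le (eps : R) (z : 'rV[R]_n) : 0 < eps <= 1 ->
  (forall j : 'rV[int]_m, grid_box delta eps j `&` I !=set0 ->
     (outer_prob P (hits v (grid_box delta eps j) (eball z eps)) <=
      (C * eps ^+ n)%:E)%E) ->
  (outer_prob P (hits v I (eball z eps)) <=
    (C * (2 * (M + 1)) ^+ m * eps `^ (n%:R - m%:R / delta))%:E)%E.
Proof.
move=> /andP[e0 e1] hbox.
set rho := eps `^ delta^-1; have rho0 : 0 < rho by rewrite powR_gt0.
have rho1 : rho <= 1.
  have one : 1 `^ delta^-1 = 1 :> R by rewrite powR1.
  by rewrite -[leRHS]one ge0_ler_powR// ?nnegrE ?invr_ge0 ?(ltW e0) ?(ltW delta0).
pose K := (Num.truncn (M / rho)).+1.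
pose idx (k : {ffun 'I_m -> 'I_(K.*2)}) : 'rV[int]_m := \row_l ((k l : nat)%:Z - K%:Z).
pose box k := grid_box delta eps (idx k).
have cover : hits v I (eball z eps) `<=`
    \big[setU/set0]_(k : {ffun 'I_m -> 'I_(K.*2)}) hits v (box k `&` I) (eball z eps).
  move=> w [_ [[x Ix <-] xz]].
  pose f l := Num.floor (x 0 l / rho).
  have fK l : (- K%:Z <= f l) && (f l < K%:Z).
    have /andP[x1 x2] : - M <= x 0 l <= M by rewrite -ler_norml IM.
    have MK : M < K%:R * rho by rewrite -ltr_pdivrMr//; exact: truncnS_gt.
    rewrite floor_ge_int floor_lt_int ler_pdivlMr// ltr_pdivrMr// mulrNz -!pmulrn.
    by apply/andP; split; lra.
  have flo l : (absz (f l + K%:Z)%R < K.*2)%N by have := fK l; lia.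
  pose k : {ffun 'I_m -> 'I_(K.*2)} := [ffun l => Ordinal (flo l)].
  rewrite -bigcup_seq; exists k; first by rewrite /= mem_index_enum.
  exists (vector_value v w x); split => //; exists x => //; split => // l.
  have -> : idx k 0 l = f l.
    rewrite /idx !mxE ffunE/=; have := fK l; lia.
  have := floor_itv (x 0 l / rho); rewrite -/(f l) ler_pdivlMr// ltr_pdivrMr//.
  by move=> /andP[-> /ltW ->].
have each k : (outer_prob P (hits v (box k `&` I) (eball z eps)) <= (C * eps ^+ n)%:E)%E.
  have [/hbox h|/nonemptyPn h] := pselect (box k `&` I !=set0).
    apply: le_trans h; apply: le_outer_measure => w [y [[x [xb _] <-] yz]].
    by exists (vector_value v w x); split => //; exists x.
  rewrite h (_ : hits _ _ _ = set0) ?outer_prob0 ?lee_fin ?mulr_ge0 ?exprn_ge0 ?(ltW e0)//.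
  by rewrite -subset0 => w [y [[]]].
apply: le_trans (le_outer_measure _ _ _ cover) _.
apply: le_trans (outer_measure_bigcup_le _ _ _) _.
apply: (@le_trans _ _ (\sum_(k : {ffun 'I_m -> 'I_(K.*2)}) (C * eps ^+ n)%:E)%E).
  by apply: lee_sum => k _; exact: each.
rewrite sumEFin lee_fin sumr_const card_ffun !card_ord.
rewrite -mulrA -mulrnAr ler_wpM2l//.
have K2 : (K.*2)%:R <= 2 * (M + 1) / rho.
  have h : (Num.truncn (M / rho))%:R <= M / rho.
    by rewrite truncn_le// divr_ge0 ?(ltW M0) ?(ltW rho0).
  have h' : 1 <= rho^-1 by rewrite invf_ge1.
  rewrite -mul2n natrM -[leRHS]mulrA ler_wpM2l// mulrDl mul1r /K -natr1; exact: lerD.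
rewrite powRB; last by rewrite (gt_eqF e0) implybT.
rewrite powR_mulrn ?(ltW e0)// [m%:R / delta]mulrC powRrM -/rho powR_mulrn ?(ltW rho0)//.
rewrite -mulr_natl natrX [leRHS](_ : _ = (2 * (M + 1) / rho) ^+ m * eps ^+ n); last first.
  by rewrite expr_div_n; ring.
apply: ler_wpM2r; first by rewrite exprn_ge0// ltW.
by apply: lerXn2r; rewrite ?nnegrE// divr_ge0 ?(ltW rho0)// mulr_ge0// addr_ge0// ltW.
Qed.

End hausdorff_covering.

Lemma hausdorff_weight_ge0 (R : realType) (gamma r : R) :
  0 <= hausdorff_weight gamma r.
Proof. by rewrite /hausdorff_weight; case: ifP => // _; exact: powR_ge0. Qed.

(** This monotonicity makes the limit defining the Hausdorff measure exist. *)
Lemma hausdorff_content_le (R : realType) n (gamma e e' : R) (A : set 'rV[R]_n) :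
  e <= e' -> (hausdorff_content gamma e' A <= hausdorff_content gamma e A)%E.
Proof.
move=> ee'; apply: ereal_inf_le_tmp => _ [x [r [Axr re ->]]].
exists x, r; split => // i; have /andP[r0 re1] := re i.
by rewrite r0 (le_trans re1).
Qed.

Section hausdorff_bound.
Context d (O : measurableType d) (R : realType) (P : probability O R).
Context (T : Type) (n : nat) (v : T -> 'I_n -> {RV P >-> R}).
Variables (I : set T) (gamma C e1 : R).
Hypotheses (gamma0 : 0 <= gamma) (C0 : 0 < C) (e10 : 0 < e1).
Hypothesis hball : forall r (z : 'rV[R]_n), 0 < r <= e1 ->
  (outer_prob P (hits v I (eball z r)) <= (C * r `^ gamma)%:E)%E.

(** Balls of radius 0 are empty, hence never hit, in accordance with their
weight 0; for the others r^gamma <= (2 r)^gamma. *)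
Lemma outer_prob_hits_le_content e (A : set 'rV[R]_n) : e <= e1 ->
  ((C^-1)%:E * outer_prob P (hits v I A) <= hausdorff_content gamma e A)%E.
Proof.
move=> ee1; apply/ereal_infP => _ [x [r [Axr re ->]]].
rewrite lee_pdivrMl//.
have cover : hits v I A `<=` \bigcup_i hits v I (eball (x i) (r i)).
  move=> w [_ [[t It <-] /Axr[i _ xi]]].
  by exists i => //; exists (vector_value v w t); split => //; exists t.
apply: le_trans (le_outer_measure _ _ _ cover) _.
apply: le_trans (outer_measure_sigma_subadditive _ _) _.
rewrite -nneseriesZl; last by move=> i _; rewrite lee_fin hausdorff_weight_ge0.
apply: lee_nneseries => i _ //.
have /andP[r0 rie] := re i; rewrite -EFinM /hausdorff_weight.
have [ri0|ri0] := eqVneq (r i) 0.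
  rewrite (_ : hits _ _ _ = set0) ?outer_measure0 ?mulr0//.
  rewrite -subset0 => w [y [_]]; rewrite /eball /= ri0 => h.
  by have := le_lt_trans (enorm_ge0 _) h; rewrite ltxx.
have ri : 0 < r i by rewrite lt_def ri0.
apply: le_trans (hball (x i) _) _; first by rewrite ri (le_trans rie).
rewrite lee_fin ler_wpM2l ?(ltW C0)// ge0_ler_powR// ?nnegrE ?mulr_ge0//.
by rewrite ler_peMl// ler1n.
Qed.

Lemma outer_prob_hits_le_hausdorff (A : set 'rV[R]_n) :
  (outer_prob P (hits v I A) <= C%:E * hausdorff gamma A)%E.
Proof.
rewrite /hausdorff ltNge gamma0 /= -lee_pdivrMl//.
apply: lime_ge.
  apply: nonincreasing_at_right_is_cvge; near=> x => e e' _ _.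
  exact: hausdorff_content_le.
near=> e; apply: outer_prob_hits_le_content; near: e.
exact: nbhs_right_le.
Unshelve. all: by end_near. Qed.

End hausdorff_bound.

Theorem theorem2p6 (R : realType) (disp : measure_display)
  (Omega : measurableType disp) (P : probability Omega R)
  (m d : nat) (hm : (1 <= m)%N) (hd : (1 <= d)%N)
  (I : set 'rV[R]_m) (hI : compact I) (hI0 : (0 < lebesgue_rV I)%E)
  (v : 'rV[R]_m -> 'I_d -> {RV P >-> R})
  (hcont : {ae P, forall w, continuous (vector_value v w)})
  (hgauss : gaussian_family (fun p : 'rV[R]_m * 'I_d => v p.1 p.2))
  (hcent : forall x i, ('E_P[v x i] = 0)%E)
  (hindep : independent_processes (fun i x => v x i))
  (hident : identically_distributed_processes (fun i x => v x i))
  (hvar : (0 < ereal_inf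
             [set 'V_P[v x (Ordinal hd)] | x in enlargement I 1])%E)
  (delta : R) (hdelta : 0 < delta <= 1)
  (hint : exists C : R, \forall eps \near 0^'+, forall j : 'rV[int]_m,
     grid_box delta eps j `&` I !=set0 ->
     (\int[P]_w \int[@lebesgue_rV R m]_(y in grid_box delta eps j)
        \int[@lebesgue_rV R m]_(ybar in grid_box delta eps j)
          (expR (enorm (vector_value v w y - vector_value v w ybar)
                 / enorm (y - ybar) `^ delta))%:E
      <= (C * eps `^ (2 * m%:R / delta))%:E)%E) :
  (exists C : R, \forall eps \near 0^'+,
     forall (z : 'rV[R]_d) (j : 'rV[int]_m),
       grid_box delta eps j `&` I !=set0 ->
       (outer_prob P (hits v (grid_box delta eps j) (eball z eps))
        <= (C * eps ^+ d)%:E)%E)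
  /\
  (exists C : R, forall A : set 'rV[R]_d, measurable A ->
     (outer_prob P (hits v I A)
      <= C%:E * hausdorff (d%:R - m%:R / delta) A)%E).
Proof.
have /andP[delta0 _] := hdelta.
have sub_enl x : I x -> enlargement I 1 x.
  move=> Ix; exists x => //; rewrite subrr /enorm big1 ?sqrtr0//.
  by move=> l _; rewrite mxE expr0n.
have [sg sg0 sgv] : exists2 sg : R, 0 < sg & forall x i, I x ->
    sg ^+ 2 <= second_moment P (v x i).
  have smE x i : (\int[P]_w ((v x i w) ^+ 2)%:E = (second_moment P (v x i))%:E)%E.
    rewrite fineK//; apply: integrable_fin_num => //.
    apply: gaussian_variable_pow_integrable; first exact: measurable_funPT.
    have := hgauss 1%N (fun=> (x, i)) (fun=> 1).
    by congr gaussian_variable; apply/funext => w; rewrite big_ord1 mul1r.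
  pose S := [set 'V_P[v x (Ordinal hd)] | x in enlargement I 1].
  (* the infimum could be +oo a priori, in which case 1 is a lower bound *)
  have [c c0 cS] : exists2 c : R, 0 < c & (c%:E <= ereal_inf S)%E.
    move: hvar; rewrite -/S; case: (ereal_inf S) => [c c0|_|//].
      by exists c => //; rewrite -lte_fin.
    by exists 1 => //; exact: leey.
  exists (Num.sqrt c); first by rewrite sqrtr_gt0.
  move=> x i Ix; rewrite sqr_sqrtr ?(ltW c0)// -lee_fin.
  rewrite -smE (second_moment_ident hident x i (Ordinal hd)) -variance_second_moment//.
  apply: (le_trans cS); apply: ereal_inf_lbound; exists x => //; exact: sub_enl.
have part1 : exists2 C : R, 0 <= C & \forall eps \near 0^'+,
     forall (z : 'rV[R]_d) (j : 'rV[int]_m), grid_box delta eps j `&` I !=set0 ->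
       (outer_prob P (hits v (grid_box delta eps j) (eball z eps)) <= (C * eps ^+ d)%:E)%E.
  have [C0 hC0] := hint.
  exists (hitting_cst m d delta sg `|C0|); first exact: hitting_cst_ge0.
  near=> eps => z j jI.
  have eps0 : 0 < eps by near: eps; exact: nbhs_right_gt.
  have hC : (\int[P]_w \int[@lebesgue_rV R m]_(y in grid_box delta eps j)
        \int[@lebesgue_rV R m]_(ybar in grid_box delta eps j)
          (expR (enorm (vector_value v w y - vector_value v w ybar)
                 / enorm (y - ybar) `^ delta))%:E
      <= (C0 * eps `^ (2 * m%:R / delta))%:E)%E.
    by move: j jI; near: eps; exact: hC0.
  have [x [xQ Ix]] := jI.
  set rho := eps `^ delta^-1; have rho0 : 0 < rho by rewrite powR_gt0.
  have rhod : rho `^ delta = eps.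
    by rewrite /rho -powRrM mulVf ?gt_eqF// powRr1// ltW.
  rewrite grid_boxE -/rho in xQ hC *.
  rewrite -[X in eball z X]rhod -[X in X ^+ d]rhod.
  apply: (hitting_box_le hd hgauss hcent hindep hcont delta0 z rho0 sg0 (normr_ge0 C0) xQ).
    by move=> i; exact: sgv.
  apply: (le_trans hC); rewrite lee_fin.
  rewrite -[2 * m%:R / delta]mulrC powRrM -/rho -natrM powR_mulrn ?(ltW rho0)//.
  by rewrite ler_wpM2r ?exprn_ge0 ?(ltW rho0)// ler_norm.
split; first by have [C _ hC] := part1; exists C.
have [C C0 hC] := part1.
have [M M0 IM] := compact_coord_bounded hI.
(* for a negative dimension the Hausdorff measure is infinite *)
have [g0|g0] := ltP (d%:R - m%:R / delta) 0.
  exists 1 => A _; rewrite /hausdorff g0 mul1e; exact: leey.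
have [e1 /= e10 he1] : exists2 e : R, 0 < e & forall eps, 0 < eps <= e -> eps <= 1 /\
   forall (z : 'rV[R]_d) (j : 'rV[int]_m), grid_box delta eps j `&` I !=set0 ->
       (outer_prob P (hits v (grid_box delta eps j) (eball z eps)) <= (C * eps ^+ d)%:E)%E.
  have [e /= e0 he] := hC.
  exists (Num.min (e / 2) 1) => [|eps /andP[eps0]]; first by rewrite lt_min divr_gt0/=.
  rewrite le_min => /andP[epse eps1]; split => //; apply: he => //=.
  by rewrite sub0r normrN gtr0_norm//; lra.
(* adding 1 keeps the constant positive, so that it can be divided out *)
exists (C * (2 * (M + 1)) ^+ m + 1) => A _.
apply: (outer_prob_hits_le_hausdorff g0 _ e10).
  by rewrite ltr_wpDl// mulr_ge0// exprn_ge0// mulr_ge0// addr_ge0// ltW.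
move=> r z r01; have [r1 hr] := he1 r r01; have /andP[r0 _] := r01.
apply: (le_trans (hits_ball_le M0 IM delta0 C0 _ (hr z))); first by rewrite r0.
by rewrite lee_fin ler_wpM2r ?powR_ge0// lerDl.
Unshelve. all: by end_near. Qed.
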